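(* Let $a$ be a positive cubefree integer, and let $c_p$ and $\widetilde c_p$ denote the local Tamagawa numbers at a prime $p$ of $E_{C_3^0}(a)$ and $\widetilde E_{C_3^0}(a)$, respectively. Then $E_{C_3^0}(a)$ (equivalently $\widetilde E_{C_3^0}(a)$) has bad reduction at $p$ if and only if $p\mid 3a$, and: (i) if $p\neq 3$ and $p\mid a$, then $c_p=3$, and $\widetilde c_p=3$ if $p\equiv 1\pmod 6$, while $\widetilde c_p=1$ if $p\equiv 2,5\pmod 6$; (ii) at $p=3$: if $a\equiv \pm1\pmod 9$ then $(c_3,\widetilde c_3)=(1,3)$; if $a\equiv\pm 2\pmod 9$ then $(c_3,\widetilde c_3)=(2,2)$; if $a\equiv \pm 4\pmod 9$ then $(c_3,\widetilde c_3)=(1,1)$; if $a\equiv 0\pmod 3$ then $(c_3,\widetilde c_3)=(3,1)$.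
   Context: For an integer $a\neq 0$, $E_{C_3^0}(a)$ is the elliptic curve $y^2+ay=x^3$ over $\mathbb{Q}$, which has the rational point $(0,0)$ of order $3$, and $\widetilde E_{C_3^0}(a)$ is the elliptic curve $y^2+ay=x^3-7a^2$, which is a model of the $3$-isogenous curve $E_{C_3^0}(a)/\langle (0,0)\rangle$. The local Tamagawa number at $p$ of an elliptic curve $E/\mathbb{Q}$ is $c_p=[E(\mathbb{Q}_p):E_0(\mathbb{Q}_p)]$, computed with respect to a $p$-minimal model, where $E_0$ denotes the points of nonsingular reduction. *)

(* Defs.v *)
From HB Require Import structures.
From mathcomp Require Import all_boot all_order all_algebra.
Set Implicit Arguments. Unset Strict Implicit. Unset Printing Implicit Defensive.
Import Order.TTheory GRing.Theory Num.Theory.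
Local Open Scope ring_scope.

(* y^2 + a1 x y + a3 y = x^3 + a2 x^2 + a4 x + a6 *)
Record wmodel := WModel { wa1 : rat; wa2 : rat; wa3 : rat; wa4 : rat; wa6 : rat }.

Definition disc (E : wmodel) : rat :=
  let b2 := wa1 E ^+ 2 + 4 * wa2 E in
  let b4 := 2 * wa4 E + wa1 E * wa3 E in
  let b6 := wa3 E ^+ 2 + 4 * wa6 E in
  let b8 := wa1 E ^+ 2 * wa6 E + 4 * wa2 E * wa6 E - wa1 E * wa3 E * wa4 E
            + wa2 E * wa3 E ^+ 2 - wa4 E ^+ 2 in
  - b2 ^+ 2 * b8 - 8 * b4 ^+ 3 - 27 * b6 ^+ 2 + 9 * b2 * b4 * b6.

(* p-adic valuation on Q (value 0 at 0 is irrelevant: 0 is treated apart) *)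
Definition vp (p : nat) (q : rat) : int :=
  if q == 0 then 0
  else (logn p `|numq q|%N)%:Z - (logn p `|denq q|%N)%:Z.

Definition pint (p : nat) (q : rat) : bool := (q == 0) || (0 <= vp p q).

Definition wint (p : nat) (E : wmodel) : bool :=
  [&& pint p (wa1 E), pint p (wa2 E), pint p (wa3 E), pint p (wa4 E) & pint p (wa6 E)].

(* the model obtained by x = u^2 x' + r, y = u^3 y' + s u^2 x' + t *)
Definition change (E : wmodel) (u r s t : rat) : wmodel :=
  WModel ((wa1 E + 2 * s) / u)
         ((wa2 E - s * wa1 E + 3 * r - s ^+ 2) / u ^+ 2)
         ((wa3 E + r * wa1 E + 2 * t) / u ^+ 3)
         ((wa4 E - s * wa3 E + 2 * r * wa2 E - (t + r * s) * wa1 E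
             + 3 * r ^+ 2 - 2 * s * t) / u ^+ 4)
         ((wa6 E + r * wa4 E + r ^+ 2 * wa2 E + r ^+ 3 - t * wa3 E - t ^+ 2
             - r * t * wa1 E) / u ^+ 6).

Definition isoQ (E E' : wmodel) : Prop :=
  exists u r s t : rat, u != 0 /\ E' = change E u r s t.

Definition p_minimal (p : nat) (E : wmodel) : Prop :=
  wint p E /\
  forall E', isoQ E E' -> wint p E' -> vp p (disc E) <= vp p (disc E').

Definition bad_reduction (p : nat) (E : wmodel) : Prop :=
  exists E', isoQ E E' /\ p_minimal p E' /\ (0 < vp p (disc E'))%R.

(* v x >= n, with the convention v 0 = +oo *)
Definition vge (K : fieldType) (v : K -> int) (x : K) (n : int) : bool :=
  (x == 0) || (n <= v x).

(* (K, v) is a complete discretely valued field with v(p) = 1 and residue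
   field F_p; this characterizes Q_p with its p-adic valuation. *)
Definition is_Qp (p : nat) (K : fieldType) (v : K -> int) : Prop :=
  [/\ (p%:R : K) != 0 /\ v p%:R = 1,
      forall x y : K, x != 0 -> y != 0 -> v (x * y) = v x + v y,
      forall (x y : K) n, vge v x n -> vge v y n -> vge v (x + y) n,
      forall x : K, vge v x 0 -> exists k : nat, vge v (x - k%:R) 1
    & forall u : nat -> K,
        (forall n : int, exists N, forall m k, (N <= m)%N -> (N <= k)%N ->
                                   vge v (u m - u k) n) ->
        exists l, forall n : int, exists N, forall m, (N <= m)%N ->
                                   vge v (u m - l) n].

Section Points.
Variables (K : fieldType) (E : wmodel).
Let A1 : K := ratr (wa1 E).
Let A2 : K := ratr (wa2 E).
Let A3 : K := ratr (wa3 E).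
Let A4 : K := ratr (wa4 E).
Let A6 : K := ratr (wa6 E).

(* None is the point at infinity O *)
Definition on_curve (P : option (K * K)) : Prop :=
  match P with
  | None => True
  | Some (x, y) => y ^+ 2 + A1 * x * y + A3 * y = x ^+ 3 + A2 * x ^+ 2 + A4 * x + A6
  end.

Definition eneg (P : option (K * K)) : option (K * K) :=
  match P with
  | None => None
  | Some (x, y) => Some (x, - y - A1 * x - A3)
  end.

Definition eadd (P Q : option (K * K)) : option (K * K) :=
  match P, Q with
  | None, _ => Q
  | _, None => P
  | Some (x1, y1), Some (x2, y2) =>
    if (x1 == x2) && (y1 + y2 + A1 * x2 + A3 == 0) then None
    else
      let l := if x1 == x2 then
                 (3 * x1 ^+ 2 + 2 * A2 * x1 + A4 - A1 * y1) / (2 * y1 + A1 * x1 + A3)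
               else (y2 - y1) / (x2 - x1) in
      let nu := y1 - l * x1 in
      let x3 := l ^+ 2 + A1 * l - A2 - x1 - x2 in
      Some (x3, - (l + A1) * x3 - nu - A3)
  end.

(* E_0(K): points whose reduction (on the model E, assumed p-integral) is a
   nonsingular point of the reduced curve *)
Definition E0 (v : K -> int) (P : option (K * K)) : bool :=
  match P with
  | None => true
  | Some (x, y) =>
    ~~ vge v x 0 ||
    ~~ (vge v (2 * y + A1 * x + A3) 1 &&
        vge v (3 * x ^+ 2 + 2 * A2 * x + A4 - A1 * y) 1)
  end.

Definition index_is (v : K -> int) (n : nat) : Prop :=
  exists pts : seq (option (K * K)),
    [/\ size pts = n,
        forall i, (i < n)%N -> on_curve (nth None pts i),
        forall P, on_curve P ->
          exists i, (i < n)%N /\ E0 v (eadd P (eneg (nth None pts i)))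
      & forall i j, (i < n)%N -> (j < n)%N ->
          E0 v (eadd (nth None pts i) (eneg (nth None pts j))) -> i = j].
End Points.

Definition tamagawa (p : nat) (K : fieldType) (v : K -> int) (E : wmodel) (c : nat) : Prop :=
  exists E', isoQ E E' /\ p_minimal p E' /\ @index_is K E' v c.

Definition cubefree (a : nat) : Prop := forall q : nat, prime q -> ~ (q ^ 3 %| a)%N.

(* E_{C_3^0}(a) : y^2 + a y = x^3  and  its 3-isogenous  y^2 + a y = x^3 - 7 a^2 *)
Definition EC3 (a : nat) : wmodel := WModel 0 0 a%:R 0 0.
Definition EC3t (a : nat) : wmodel := WModel 0 0 a%:R 0 (- 7 * a%:R ^+ 2).
Arguments tamagawa p K v E c : clear implicits.
Arguments is_Qp p K v : clear implicits.

(* Main.v *)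
(* Both curves have models y^2 + a3 y = x^3 + a6, which are minimal at p because of the valuation
   of the discriminant; at 3, where the valuation can reach 13, one also uses that c4 = 0 and
   c6^2 = -1728 disc force v(disc) >= 3 for every integral model. When the Tamagawa number is 1,
   comparing valuations, or residues modulo 9, shows that no point has singular reduction. When it
   is 2 or 3, the singular points are covered by the translates of a 2- or 3-torsion point over Q_p:
   the chord through a singular point and a suitable torsion point has slope of valuation <= 0, so
   the third intersection point reduces to a nonsingular point. The torsion points come from cube
   roots of unity when p = 1 mod 3 and from cube roots of elements of 1 + 9 Z_3 when p = 3; these
   exist by a contraction argument in the complete field. *)
Require Import Defs.
From HB Require Import structures.
From mathcomp Require Import all_boot all_order all_algebra.
From mathcomp Require Import finfield zify ring.
Import Order.TTheory GRing.Theory Num.Theory.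

(** * Congruences modulo 9 *)

(** Modulo 9 a cube is 0, 1 or -1, so [4 * k ^ 3] is 0, 4 or 5, while [a ^ 2] is 1 or 7. The
    excluded units 2 and 7 have square 4, and 4 + 5 = 9. *)
Lemma cube_plus_square_mod9 a k : (a %% 9 \in [:: 1; 8; 4; 5] -> ~~ (9 %| 4 * k ^ 3 + a ^ 2))%N.
Proof.
rewrite /dvdn -modnDm -modnMmr -(modnXm 3) -[a ^ 2 %% 9]modnXm.
have : (k %% 9 < 9)%N by rewrite ltn_mod.
move: (k %% 9)%N (a %% 9)%N => r s r9.
by do 9![case: r r9 => [|r] r9; first by rewrite !inE => /or4P[] /eqP->].
Qed.

(** Here [a ^ 2] is 7 and [12 * m ^ 2] is 0 or 3 modulo 9, so the right-hand side is 7 or 1, whereas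
    [4 * k ^ 3] is 0, 4 or 5. *)
Lemma cube_neq_square_mod9 a k m : (a %% 9 \in [:: 4; 5] -> 4 * k ^ 3 != a ^ 2 + 12 * m ^ 2 %[mod 9])%N.
Proof.
rewrite -modnMmr -(modnXm 3) -[in X in _ -> _ != X]modnDm -[(12 * _) %% 9]modnMmr.
rewrite -[a ^ 2 %% 9]modnXm -[m ^ 2 %% 9]modnXm.
have : (k %% 9 < 9)%N by rewrite ltn_mod.
have : (m %% 9 < 9)%N by rewrite ltn_mod.
move: (k %% 9)%N (m %% 9)%N (a %% 9)%N => r t s t9 r9.
by do 9![case: t t9 => [|t] t9; first by rewrite !inE => /orP[] /eqP->;
  do 9![case: r r9 => [|r] r9; first by []]].
Qed.

(** * Cube roots of unity in the prime field *)

Section FiniteField.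
Local Open Scope ring_scope.

Lemma dvdn_Fp p n : prime p -> (p %| n)%N = (n%:R == 0 :> 'F_p).
Proof. by move=> pp; rewrite (dvdn_pcharf (pchar_Fp pp)). Qed.

(** With [m = (p - 1) / 3], the polynomial [X^m - 1] has at most [m] roots, so some nonzero [z] has
    [z ^+ m != 1]; then [z ^+ m] is a primitive cube root of unity. *)
Lemma exists_order3 p : prime p -> (p %% 3 = 1)%N -> exists w : nat, (p %| w ^ 2 + w + 1)%N.
Proof.
move=> pp p1; set m := (p.-1 %/ 3)%N; have p_gt1 := prime_gt1 pp.
have pm : p.-1 = (m * 3)%N by rewrite /m; lia.
have [z z0 zm] : exists2 z : 'F_p, z != 0 & z ^+ m != 1.
  case: (pickP [pred z : 'F_p | (z != 0) && (z ^+ m != 1)]) => [z /andP[]|z1].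
    by exists z.
  have m_gt0 : (0 < m)%N by lia.
  have : (size (enum (predC1 (0%R : 'F_p))) < size ('X^m - 1 : {poly 'F_p})%R)%N.
    apply: max_poly_roots; rewrite ?enum_uniq //.
      by rewrite -size_poly_gt0 size_XnsubC.
    apply/allP => z; rewrite mem_enum !inE => z0; have /= := z1 z.
    by rewrite z0 rootE !hornerE subr_eq0 => /negbFE.
  by rewrite size_XnsubC // -cardE cardC1 card_Fp // pm; lia.
have w3 : (z ^+ m) ^+ 3 = 1 :> 'F_p.
  apply: (mulfI z0); rewrite mulr1 -exprM -pm -exprS prednK ?prime_gt0 //.
  by have := expf_card z; rewrite card_Fp.
exists (z ^+ m : 'F_p); rewrite dvdn_Fp // !natrD natrX natr_Zp.
have : (z ^+ m - 1) * ((z ^+ m) ^+ 2 + z ^+ m + 1) = 0.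
  by rewrite -(subrr 1) -{3}w3; ring.
by move/eqP; rewrite mulf_eq0 subr_eq0 (negPf zm).
Qed.

(** The substitution [k = 3 w + 1] turns [k ^ 2 + k + 7] into [9 (w ^ 2 + w + 1)]. A root [w] would
    satisfy [w ^+ 3 = 1] and [w ^+ p = w], hence [w ^+ 2 = w] as [p] is 2 modulo 3; but neither 0
    nor 1 is a root, since 3 is invertible. *)
Lemma no_root_2mod3 p k : prime p -> (p %% 3 = 2)%N -> ~~ (p %| k ^ 2 + k + 7)%N.
Proof.
move=> pp p2; rewrite dvdn_Fp // !natrD natrX; set u : 'F_p := k%:R.
apply/eqP => e.
have n3 : (3 : 'F_p) != 0.
  by rewrite -dvdn_Fp // dvdn_prime2 //; apply: contra_eqN p2 => /eqP ->.
pose w := (u - 1) / 3; have ew : w ^+ 2 + w + 1 = 0.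
  have -> : w ^+ 2 + w + 1 = (u ^+ 2 + u + 7) / 9.
    by rewrite /w; field; rewrite ?n3 // (natrM _ 3 3) mulf_neq0.
  by rewrite e mul0r.
have w3 : w ^+ 3 = 1.
  have -> : w ^+ 3 = (w - 1) * (w ^+ 2 + w + 1) + 1 by ring.
  by rewrite ew mulr0 add0r.
have : w ^+ p = w by have := expf_card w; rewrite card_Fp.
have -> : w ^+ p = w ^+ (3 * (p %/ 3) + 2)%N by congr (_ ^+ _); lia.
rewrite exprD exprM w3 expr1n mul1r => w2.
have : w * (w - 1) = 0 by rewrite mulrBr -expr2 w2 mulr1 subrr.
move/eqP; rewrite mulf_eq0 subr_eq0 => /orP[] /eqP w01; move: ew; rewrite w01.
  by rewrite expr0n /= !add0r => /eqP; rewrite oner_eq0.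
have e3 : (3 : 'F_p) = 1 + 1 + 1 by ring.
by rewrite expr1n -e3; apply/eqP.
Qed.

End FiniteField.

(** * Calculus of the valuation on the p-adic field *)

Section Valuation.
Local Open Scope ring_scope.
Variables (p : nat) (K : fieldType) (v : K -> int).
Hypotheses (p_prime : prime p) (Qp : is_Qp p K v).

Local Notation vge := (vge v).

Lemma p_neq0 : p%:R != 0 :> K. Proof. by case: Qp => -[]. Qed.
Lemma v_p : v p%:R = 1. Proof. by case: Qp => -[]. Qed.

Lemma vM x y : x != 0 -> y != 0 -> v (x * y) = v x + v y.
Proof. by case: Qp => _ + _ _ _; apply. Qed.

Lemma v1 : v 1 = 0.
Proof. by have := vM 1 1 (oner_neq0 K) (oner_neq0 K); rewrite mulr1; lia. Qed.

Lemma vN x : v (- x) = v x.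
Proof.
have [->|x0] := eqVneq x 0; first by rewrite oppr0.
have N1 : (- 1 : K) != 0 by rewrite oppr_eq0 oner_eq0.
have := vM _ _ N1 N1; rewrite mulrNN mulr1 v1 => ?.
by rewrite -mulN1r vM //; lia.
Qed.

Lemma vV x : x != 0 -> v x^-1 = - v x.
Proof.
move=> x0; have := vM x x^-1 x0; rewrite invr_eq0 divff // v1.
by move/(_ x0); lia.
Qed.

Lemma vX x n : x != 0 -> v (x ^+ n) = v x *+ n.
Proof.
move=> x0; elim: n => [|n IH]; first by rewrite expr0 v1.
by rewrite exprS vM ?expf_neq0 // IH mulrS.
Qed.

Lemma vge0 n : vge 0 n. Proof. by rewrite /Defs.vge eqxx. Qed.

Lemma vgeE x n : x != 0 -> vge x n = (n <= v x).
Proof. by rewrite /Defs.vge => /negPf->. Qed.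

Lemma vge_le m n x : m <= n -> vge x n -> vge x m.
Proof.
by move=> mn; rewrite /Defs.vge; case: eqP => //= _; apply: le_trans.
Qed.

Lemma vgeD x y n : vge x n -> vge y n -> vge (x + y) n.
Proof. by case: Qp => _ _ + _ _; apply. Qed.

Lemma vgeN x n : vge (- x) n = vge x n.
Proof. by rewrite /Defs.vge oppr_eq0 vN. Qed.

Lemma vgeB x y n : vge x n -> vge y n -> vge (x - y) n.
Proof. by move=> ? ?; rewrite vgeD // vgeN. Qed.

Lemma vgeDl x y n : vge y n -> vge (x + y) n = vge x n.
Proof.
move=> yn; apply/idP/idP => [xyn|xn]; last exact: vgeD.
by rewrite -(addrK y x) vgeB.
Qed.

Lemma vgeDr x y n : vge x n -> vge (x + y) n = vge y n.
Proof. by move=> ?; rewrite addrC vgeDl. Qed.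

Lemma vgeM x y m n : vge x m -> vge y n -> vge (x * y) (m + n).
Proof.
rewrite /Defs.vge mulf_eq0; have [//|x0] := eqVneq x 0.
by have [//|y0 /=] := eqVneq y 0; rewrite vM //; lia.
Qed.

Lemma vgeMl x y n : vge x 0 -> vge y n -> vge (x * y) n.
Proof. by move=> x0 yn; rewrite -[n]add0r vgeM. Qed.

Lemma vgeMr x y n : vge x n -> vge y 0 -> vge (x * y) n.
Proof. by rewrite mulrC => xn y0; apply: vgeMl. Qed.

Lemma vge1 : vge 1 0. Proof. by rewrite /Defs.vge v1 lexx orbT. Qed.

Lemma vgeX x n k : vge x n -> vge (x ^+ k) (n *+ k).
Proof.
move=> xn; elim: k => [|k IH]; first by rewrite expr0 mulr0n vge1.
by rewrite exprS mulrS vgeM.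
Qed.

Lemma vge_nat n : vge n%:R 0.
Proof. by elim: n => [|n IH]; rewrite ?vge0 // -natr1 vgeD // vge1. Qed.

Lemma vge_p : vge p%:R 1. Proof. by rewrite vgeE ?p_neq0 ?v_p. Qed.

Lemma vge_dvd n : (p %| n)%N -> vge n%:R 1.
Proof.
case/dvdnP=> m ->; rewrite natrM; apply: vgeMl (vge_nat _) vge_p.
Qed.

(** Otherwise a Bezout relation between [p] and [n] would give 1 a positive valuation. *)
Lemma coprime_vge n : coprime p n -> ~~ vge n%:R 1.
Proof.
move=> cop; have p0 := prime_gt0 p_prime.
case: (egcdnP n p0) => a b def_gcd _; apply/negP => nn.
suff: vge 1 1 by rewrite vgeE ?oner_neq0 // v1.
have := congr1 (fun k : nat => k%:R : K) def_gcd.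
rewrite /= (eqP cop) natrD !natrM => e.
have -> : 1 = a%:R * p%:R - b%:R * n%:R :> K by rewrite e; ring.
by apply: vgeB; apply: vgeMl; rewrite ?vge_nat ?vge_p.
Qed.

Lemma nat_neq0 n : (0 < n)%N -> n%:R != 0 :> K.
Proof.
move=> n0; case: (pfactor_coprime p_prime n0) => m cop def_n.
rewrite def_n natrM natrX mulf_neq0 ?expf_neq0 ?p_neq0 //.
by apply: contraNneq (coprime_vge _ cop) => ->; rewrite vge0.
Qed.

Lemma v_nat n : (0 < n)%N -> v n%:R = (logn p n)%:Z.
Proof.
move=> n0; case: (pfactor_coprime p_prime n0) => m cop def_n.
have m0 : (0 < m)%N by move: n0; rewrite def_n muln_gt0 => /andP[].
rewrite {1}def_n natrM natrX vM ?expf_neq0 ?p_neq0 ?nat_neq0 //.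
have := coprime_vge _ cop; have := vge_nat m.
rewrite !vgeE ?nat_neq0 // vX ?p_neq0 // v_p; lia.
Qed.

(** * The embedding of the rationals and its compatibility with [vp] *)

Lemma int_neq0 (z : int) : z != 0 -> z%:~R != 0 :> K.
Proof.
by case: (intP z) => // n _; rewrite ?mulrNz ?oppr_eq0 -pmulrn nat_neq0.
Qed.

Lemma v_int (z : int) : z != 0 -> v z%:~R = (logn p `|z|%N)%:Z.
Proof.
by case: (intP z) => // n _; rewrite ?mulrNz ?vN -pmulrn v_nat ?abszN.
Qed.

Lemma vge_intE (z : int) (k : nat) : vge z%:~R k%:Z = (p ^ k %| `|z|)%N.
Proof.
have [->|z0] := eqVneq z 0; first by rewrite vge0 dvdn0.
by rewrite vgeE ?int_neq0 // v_int // pfactor_dvdn // absz_gt0.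
Qed.

(* The library proves that [ratr] is a morphism only for ordered fields. *)
Lemma ratr_frac (n d : int) : d != 0 -> ratr (n%:~R / d%:~R) = n%:~R / d%:~R :> K.
Proof.
move=> d0; set q : rat := _ / _.
have dq : (d%:~R : rat) != 0 by rewrite intr_eq0.
have : numq q * d = n * denq q.
  apply: (@intr_inj rat); rewrite !rmorphM /= numqE mulrAC.
  by rewrite {1}/q divfK.
move/(congr1 (fun z : int => z%:~R : K)); rewrite /= !rmorphM /= => e.
rewrite /ratr; apply/eqP; rewrite eqr_div ?int_neq0 ?denq_neq0 //.
by rewrite e.
Qed.

Lemma ratrM : {morph (ratr : rat -> K) : x y / x * y}.
Proof.
move=> x y; rewrite -{1}[x]divq_num_den -{1}[y]divq_num_den mulf_div -!rmorphM /=.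
by rewrite ratr_frac ?mulf_neq0 ?denq_neq0 // /ratr !rmorphM mulf_div.
Qed.

Lemma ratrD : {morph (ratr : rat -> K) : x y / x + y}.
Proof.
move=> x y; rewrite -{1}[x]divq_num_den -{1}[y]divq_num_den.
rewrite addf_div ?intr_eq0 ?denq_neq0 // -!rmorphM /= -rmorphD /=.
rewrite ratr_frac ?mulf_neq0 ?denq_neq0 // /ratr rmorphD !rmorphM /=.
by rewrite addf_div ?int_neq0 ?denq_neq0.
Qed.

Lemma ratrN : {morph (ratr : rat -> K) : x / - x}.
Proof. by move=> x; rewrite /ratr numqN denqN mulrNz mulNr. Qed.

Lemma ratr_eq0 q : (ratr q == 0 :> K) = (q == 0).
Proof.
rewrite /ratr mulf_eq0 invr_eq0 (negPf (int_neq0 _ (denq_neq0 q))) orbF.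
have [->|q0] := eqVneq q 0; first by rewrite eqxx.
by apply/negbTE/int_neq0; rewrite numq_eq0.
Qed.

Lemma v_ratr q : q != 0 -> v (ratr q) = vp p q.
Proof.
move=> q0; have nq : numq q != 0 by rewrite numq_eq0.
rewrite /vp (negPf q0) /ratr vM ?invr_eq0 ?int_neq0 ?denq_neq0 //.
by rewrite vV ?int_neq0 ?denq_neq0 // !v_int ?denq_neq0.
Qed.

Lemma pintE q : pint p q = vge (ratr q) 0.
Proof.
rewrite /pint /Defs.vge ratr_eq0; have [//|q0 /=] := eqVneq q 0.
by rewrite v_ratr.
Qed.

(** * Fixed points by completeness, and the roots they provide *)

Lemma vge_eq0 x : (forall n, vge x n) -> x = 0.
Proof.
by move=> xn; apply/eqP; apply: contraT => x0; have := xn (v x + 1); rewrite vgeE //; lia.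
Qed.

(** Banach's argument: the differences of successive iterates from 0 gain one unit of valuation at
    each step, so the iterates converge in the ball, and [g l - l] is divisible by every power of
    [p]. *)
Lemma contraction (g : K -> K) (N : int) :
    (forall x, vge x N -> vge (g x) N) ->
    (forall x y n, vge x N -> vge y N -> vge (x - y) n -> vge (g x - g y) (n + 1)) ->
  exists2 l, vge l N & g l = l.
Proof.
move=> gN gC; pose u n := iter n g 0.
have uN n : vge (u n) N by elim: n => [|n IH]; [exact: vge0 | exact: gN].
have u_step n : vge (u n.+1 - u n) (N + n%:Z).
  elim: n => [|n IH]; first by rewrite subr0 addr0 uN.
  by apply: vge_le (gC _ _ _ (uN _) (uN _) IH); lia.
have u_add k n : vge (u (k + n)%N - u k) (N + k%:Z).
  elim: n => [|n IH]; first by rewrite addn0 subrr vge0.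
  rewrite addnS -(subrK (u (k + n)%N) (u _.+1)) -addrA vgeD //.
  by apply: vge_le (u_step _); lia.
case: Qp => _ _ _ _ /(_ u) [|l ul].
  move=> n; exists `|n - N|%N.
  have half m k : (`|n - N| <= m)%N -> (m <= k)%N -> vge (u k - u m) n.
    by move=> nm /subnKC<-; apply: vge_le (u_add _ _); lia.
  move=> m k nm nk; case: (leqP m k) => [|/ltnW] mk; last exact: half.
  by rewrite -vgeN opprB half.
exists l.
  have [m /(_ m (leqnn m))] := ul N.
  by move=> ulm; rewrite -[l](subKr (u m)) vgeB.
apply/eqP; rewrite -subr_eq0; apply/eqP/vge_eq0 => n.
have [m1 um] := ul n; have [m2 uN'] := ul N.
pose m := maxn m1 m2.
have lN : vge l N by rewrite -[l](subKr (u m)) vgeB // uN' // leq_maxr.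
have -> : g l - l = (g l - g (u m)) + (u m.+1 - l) by rewrite addrA subrK.
rewrite vgeD //; last by rewrite um // (leq_trans (leq_maxl _ _) (leqnSn _)).
apply: (vge_le n (n + 1)); first by lia.
by apply: gC; rewrite // -vgeN opprB um // leq_maxl.
Qed.

Lemma residue x : vge x 0 -> exists k : nat, vge (x - k%:R) 1.
Proof. by case: Qp => _ _ _ + _; apply. Qed.

(** With [x = 1 + 3 z] the equation becomes [z = d - 3 z ^+ 2 - 3 z ^+ 3], whose right-hand side
    contracts the integers of [K]. *)
Lemma cube_root d : p = 3%N -> vge d 0 ->
  exists2 x, vge (x - 1) 1 & x ^+ 3 = 1 + 9 * d.
Proof.
move=> p3 d0; have v3 : vge 3 1 by have := vge_p; rewrite p3.
have [|x y n x0 y0 xy|z z0 ez] := contraction (fun z => d - 3 * z ^+ 2 - 3 * z ^+ 3) 0.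
- move=> x x0; have ? k := vgeX _ _ k x0.
  by rewrite !vgeB // vgeMl ?vge_nat // -(mul0rn _ 2) -(mul0rn _ 3).
- have -> : d - 3 * x ^+ 2 - 3 * x ^+ 3 - (d - 3 * y ^+ 2 - 3 * y ^+ 3) =
     - (x + y + x ^+ 2 + x * y + y ^+ 2) * (x - y) * 3 by ring.
  rewrite vgeM // vgeMl // vgeN !vgeD // ?vgeMl // -(mul0rn _ 2); exact: vgeX.
have ed : d = z + 3 * z ^+ 2 + 3 * z ^+ 3 by rewrite -{1}ez; ring.
exists (1 + 3 * z); last by rewrite ed; ring.
by rewrite addrC addKr vgeMr.
Qed.

(** Hensel lifting: at [w + z] the polynomial is [c + d z + z ^+ 2] with [d = 2 w + 1] a unit, so
    [z] is sought as a fixed point of [- (c + z ^+ 2) / d] in the maximal ideal. *)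
Lemma quadratic_root (w : K) :
    vge w 0 -> vge (w ^+ 2 + w + 1) 1 -> ~~ vge (2 * w + 1) 1 ->
  exists2 x, vge x 0 & x ^+ 2 + x + 1 = 0.
Proof.
move=> w0 fw dw; set c := _ ^+ 2 + _ + _ in fw; set d := 2 * w + 1 in dw.
have dn0 : d != 0 by apply: contraNneq dw => ->; rewrite vge0.
have d0 : vge d^-1 0.
  by move: dw; rewrite !vgeE ?invr_eq0 // vV //; lia.
have [|x y n x0 y0 xy|z z0 ez] := contraction (fun z => d^-1 * - (c + z ^+ 2)) 1.
- move=> x x1; rewrite vgeMl // vgeN vgeD //; apply: vge_le (vgeX _ _ 2 x1); lia.
- have -> : d^-1 * - (c + x ^+ 2) - d^-1 * - (c + y ^+ 2) = d^-1 * ((x - y) * - (x + y)) by ring.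
  by rewrite vgeMl // vgeM // vgeN vgeD.
exists (w + z); first by rewrite vgeD //; apply: vge_le z0; lia.
have -> : (w + z) ^+ 2 + (w + z) + 1 = c + z ^+ 2 + d * z by rewrite /c /d; ring.
by rewrite -[X in d * X]ez mulrA divff // mul1r subrr.
Qed.

Lemma ratr_natr n : ratr n%:R = n%:R :> K. Proof. exact: ratr_nat. Qed.

Lemma ratrX q n : ratr (q ^+ n) = ratr q ^+ n :> K.
Proof. by elim: n => [|n IH]; rewrite ?expr0 ?(ratr_natr 1) // !exprS ratrM IH. Qed.

Lemma ratrV q : ratr q^-1 = (ratr q)^-1 :> K.
Proof.
have [->|q0] := eqVneq q 0; first by rewrite invr0 /ratr mul0r invr0.
apply: (@mulfI _ (ratr q)); rewrite ?ratr_eq0 // -ratrM !divff ?ratr_eq0 //.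
exact: ratr_natr 1%N.
Qed.

Definition ratrE := (ratr_natr, ratrX, ratrM, ratrD, ratrN, ratrV).

Lemma vgeX0 x k : vge x 0 -> vge (x ^+ k) 0.
Proof. by move/(vgeX _ _ k); rewrite mul0rn. Qed.

Ltac integral := repeat first
  [ assumption | exact: vge_nat | exact: vge1 | exact: vge0 | rewrite vgeN | apply: vgeD
  | apply: vgeMl | apply: vgeX0 ].

(** The valuation of a power is a multiple of the exponent [k.+1], so a defect of at most [k] can be
    rounded away. *)
Lemma vgeX_root x n k : vge (x ^+ k.+1) (n *+ k.+1 - k%:Z) -> vge x n.
Proof.
have [->|x0] := eqVneq x 0; first by rewrite vge0.
rewrite !vgeE ?expf_neq0 // vX //; apply: contraTT; rewrite -!ltNge => lt_xn.
have : v x *+ k.+1 <= (n - 1) *+ k.+1 by rewrite lerMn2r; lia.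
by rewrite mulrnBl natz; lia.
Qed.

(** * Invariants of Weierstrass models and criteria for minimality *)

Definition b2 (E : wmodel) : rat := wa1 E ^+ 2 + 4 * wa2 E.
Definition b4 (E : wmodel) : rat := 2 * wa4 E + wa1 E * wa3 E.
Definition b6 (E : wmodel) : rat := wa3 E ^+ 2 + 4 * wa6 E.

(** Since [4 b8 = b2 b6 - b4 ^+ 2], the discriminant depends only on [b2], [b4] and [b6], whose
    changes of variables involve only [u] and [r]. *)
Lemma discE E : disc E =
  - b2 E ^+ 2 * ((b2 E * b6 E - b4 E ^+ 2) / 4) - 8 * b4 E ^+ 3 - 27 * b6 E ^+ 2
  + 9 * b2 E * b4 E * b6 E.
Proof.
case: E => a1 a2 a3 a4 a6; rewrite /b2 /b4 /b6 /=.
suff -> : ((a1 ^+ 2 + 4 * a2) * (a3 ^+ 2 + 4 * a6) - (2 * a4 + a1 * a3) ^+ 2) / 4 =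
   a1 ^+ 2 * a6 + 4 * a2 * a6 - a1 * a3 * a4 + a2 * a3 ^+ 2 - a4 ^+ 2 by [].
by field.
Qed.

Lemma b2_change E u r s t : u != 0 -> b2 (change E u r s t) = (b2 E + 12 * r) / u ^+ 2.
Proof. by case: E => a1 a2 a3 a4 a6 u0; rewrite /b2 /=; field. Qed.

Lemma b4_change E u r s t : u != 0 ->
  b4 (change E u r s t) = (b4 E + r * b2 E + 6 * r ^+ 2) / u ^+ 4.
Proof. by case: E => a1 a2 a3 a4 a6 u0; rewrite /b2 /b4 /=; field. Qed.

Lemma b6_change E u r s t : u != 0 ->
  b6 (change E u r s t) = (b6 E + 2 * r * b4 E + r ^+ 2 * b2 E + 4 * r ^+ 3) / u ^+ 6.
Proof. by case: E => a1 a2 a3 a4 a6 u0; rewrite /b2 /b4 /b6 /=; field. Qed.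

Lemma disc_change E u r s t : u != 0 -> disc (change E u r s t) = disc E / u ^+ 12.
Proof.
move=> u0; rewrite !discE b2_change // b4_change // b6_change //.
by move: (b2 E) (b4 E) (b6 E) => x y z; field.
Qed.

Definition c4 (E : wmodel) : rat := b2 E ^+ 2 - 24 * b4 E.

Lemma c4_change E u r s t : u != 0 -> c4 (change E u r s t) = c4 E / u ^+ 4.
Proof.
move=> u0; rewrite /c4 b2_change // b4_change //.
by move: (b2 E) (b4 E) => x y; field.
Qed.

Lemma wintP E : wint p E ->
  [/\ vge (ratr (wa1 E)) 0, vge (ratr (wa2 E)) 0, vge (ratr (wa3 E)) 0,
      vge (ratr (wa4 E)) 0 & vge (ratr (wa6 E)) 0].
Proof. by rewrite /wint !pintE => /and5P. Qed.

Lemma wint_disc E : wint p E -> vge (ratr (disc E)) 0.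
Proof.
by case/wintP=> i1 i2 i3 i4 i6; rewrite /disc !ratrE; integral.
Qed.

Lemma vge_natM k x n : (0 < k)%N -> vge (k%:R * x) n = vge x (n - (logn p k)%:Z).
Proof.
move=> k0; have [->|x0] := eqVneq x 0; first by rewrite mulr0 !vge0.
by rewrite !vgeE ?mulf_neq0 ?nat_neq0 // vM ?nat_neq0 // v_nat //; lia.
Qed.

(* When [c4 = 0] the relation [1728 disc = c4 ^+ 3 - c6 ^+ 2] reads
   [12 disc = - (b2 b4 - 18 b6) ^+ 2], and 3 divides [b2] and [b4]. *)
Lemma wint_disc3 E : p = 3%N -> wint p E -> c4 E = 0 -> vge (ratr (disc E)) 3.
Proof.
move=> p3 /wintP[i1 i2 i3 i4 i6] c40.
pose x : K := ratr (b2 E); pose y : K := ratr (b4 E); pose z : K := ratr (b6 E).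
have z0 : vge z 0 by rewrite /z /b6 !ratrE; integral.
have y0 : vge y 0 by rewrite /y /b4 !ratrE; integral.
have eqb : b2 E ^+ 2 = 24 * b4 E by apply/eqP; rewrite -subr_eq0; apply/eqP.
have xy : x ^+ 2 = 24 * y by rewrite /x /y -ratrX eqb ratrM ratr_natr.
have x1 : vge x 1 by apply: (vgeX_root _ _ 1); rewrite xy vge_natM // p3.
have y1 : vge y 1 by have := vgeX _ _ 2 x1; rewrite xy vge_natM // p3.
have ed : 12 * disc E = - (b2 E * b4 E - 18 * b6 E) ^+ 2.
  have -> : 12 * disc E = 3 * b2 E ^+ 2 * b4 E ^+ 2 - 3 * b2 E ^+ 2 * b2 E * b6 E
      - 96 * b4 E ^+ 3 - 324 * b6 E ^+ 2 + 108 * b2 E * b4 E * b6 E.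
    by rewrite discE; move: (b2 E) (b4 E) (b6 E) => X Y Z; field.
  have -> : (b2 E * b4 E - 18 * b6 E) ^+ 2 =
     b2 E ^+ 2 * b4 E ^+ 2 - 36 * b2 E * b4 E * b6 E + 324 * b6 E ^+ 2.
    by move: (b2 E) (b4 E) (b6 E) => X Y Z; ring.
  by rewrite eqb; move: (b2 E) (b4 E) (b6 E) => X Y Z; ring.
have : vge (12 * ratr (disc E)) 4.
  have xyz : vge (x * y - 18 * z) 2.
    by rewrite vgeB ?(vgeM _ _ 1 1 x1 y1) // vge_natM // p3; apply: vge_le z0.
  have -> : 12 * ratr (disc E) = - (x * y - 18 * z) ^+ 2.
    by rewrite -(ratr_natr 12) -ratrM ed /x /y /z !ratrE.
  by rewrite vgeN; exact: (vgeX _ _ 2 xyz).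
by rewrite vge_natM // p3.
Qed.

Lemma isoQ_refl E : isoQ E E.
Proof.
exists 1, 0, 0, 0; split; first exact: oner_neq0.
by case: E => a1 a2 a3 a4 a6; rewrite /change /=; congr WModel; field.
Qed.

Lemma isoQ_disc E E' : isoQ E E' -> disc E != 0 ->
  disc E' != 0 /\ exists n : int, vp p (disc E') = vp p (disc E) - n *+ 12.
Proof.
case=> [u [r [s [t [u0 ->]]]]] d0; rewrite disc_change //.
have d0' : disc E / u ^+ 12 != 0 by rewrite mulf_neq0 // invr_eq0 expf_neq0.
split=> //; exists (v (ratr u)).
rewrite -!v_ratr // ratrM ratrV ratrX.
by rewrite vM ?invr_eq0 ?expf_neq0 ?ratr_eq0 // vV ?expf_neq0 ?ratr_eq0 // vX ?ratr_eq0.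
Qed.

Lemma wint_vp E : wint p E -> disc E != 0 -> 0 <= vp p (disc E).
Proof. by move=> /wint_disc + d0; rewrite vgeE ?ratr_eq0 // v_ratr. Qed.

(** Valuations of discriminants of isomorphic models differ by multiples of 12, and are nonnegative
    for integral models. *)
Lemma minimal_lt12 E : wint p E -> disc E != 0 -> vp p (disc E) < 12 -> p_minimal p E.
Proof.
move=> iE d0 lt12; split=> // E' /isoQ_disc/(_ d0)[d0' [n en]] iE'.
by have := wint_vp _ iE' d0'; lia.
Qed.

(** An integral model with a smaller discriminant would have valuation at most 14 - 12 = 2, below
    the bound 3 of [wint_disc3]. *)
Lemma minimal_c4 E : p = 3%N -> wint p E -> disc E != 0 -> c4 E = 0 ->
  vp p (disc E) < 15 -> p_minimal p E.
Proof.
move=> p3 iE d0 c40 lt15; split=> // E' isoE iE'.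
have [d0' [n en]] := isoQ_disc _ _ isoE d0.
have c40' : c4 E' = 0.
  by case: isoE => [u [r [s [t [u0 ->]]]]]; rewrite c4_change // c40 mul0r.
have := wint_disc3 _ p3 iE' c40'.
by rewrite vgeE ?ratr_eq0 // v_ratr //; lia.
Qed.

Lemma minimal_bad E E' : isoQ E E' -> p_minimal p E' -> 0 < vp p (disc E') -> bad_reduction p E.
Proof. by exists E'. Qed.

Lemma change_inv E u r s t : u != 0 ->
  change (change E u r s t) u^-1 (- r / u ^+ 2) (- s / u) ((r * s - t) / u ^+ 3) = E.
Proof. by case: E => a1 a2 a3 a4 a6 u0; rewrite /change /=; congr WModel; field. Qed.

(** The minimality of a supposed bad model is tested against [E] itself, reached by the inverse
    change of variables. *)
Lemma good_reduction E : wint p E -> disc E != 0 -> vp p (disc E) = 0 -> ~ bad_reduction p E.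
Proof.
move=> iE d0 vd [E' [[u [r [s [t [u0 def_E']]]]] [[_ minE'] badE']]].
suff /minE'/(_ iE) : isoQ E' E by rewrite vd; lia.
exists u^-1, (- r / u ^+ 2), (- s / u), ((r * s - t) / u ^+ 3).
by rewrite invr_eq0 def_E' change_inv.
Qed.

Lemma vgeM_unit x y n : vge x 0 -> ~~ vge x 1 -> vge (x * y) n = vge y n.
Proof.
move=> x0 x1; have xn0 : x != 0 by apply: contraNneq x1 => ->; rewrite vge0.
have [->|yn0] := eqVneq y 0; first by rewrite mulr0.
by move: x0 x1; rewrite !vgeE ?mulf_neq0 // vM //; lia.
Qed.

Lemma vge_nat_unit k x n : coprime p k -> vge (k%:R * x) n = vge x n.
Proof. by move=> pk; rewrite vgeM_unit ?vge_nat ?coprime_vge. Qed.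

Lemma vge_square x : vge (x ^+ 2) 1 -> vge x 1.
Proof. exact: (vgeX_root _ 1 1). Qed.

Lemma vge_cube x : vge (x ^+ 3) 1 -> vge x 1.
Proof. by move=> x1; apply: (vgeX_root _ 1 2); apply: vge_le x1. Qed.

Lemma vge_factor (x y : K) (n : int) :
  vge (x * y) (n + n + 1) -> vge x (n + 1) || vge y (n + 1).
Proof.
move=> xyn; have [->|x0] := eqVneq x 0; first by rewrite vge0.
have [->|y0] := eqVneq y 0; first by rewrite vge0 orbT.
by move: xyn; rewrite !vgeE ?mulf_neq0 // vM //; lia.
Qed.

Lemma vge_cancel (x y : K) (m n : int) : vge (x * y) (m + n) -> ~~ vge y (n + 1) -> vge x m.
Proof.
move=> xyn y1; have y0 : y != 0 by apply: contraNneq y1 => ->; rewrite vge0.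
have [->|x0] := eqVneq x 0; first by rewrite vge0.
by move: xyn y1; rewrite !vgeE ?mulf_neq0 // vM //; lia.
Qed.

(** * Indices of the points of nonsingular reduction on [y^2 + a3 y = x^3 + a6] *)

Definition cubic_model (a3 a6 : rat) : wmodel := WModel 0 0 a3 0 a6.

Section CubicModel.
Variables (a3 a6 : rat) (A B : K).
Hypotheses (def_A : ratr a3 = A) (def_B : ratr a6 = B).
Let E := cubic_model a3 a6.

Lemma ratr0 : ratr 0 = 0 :> K. Proof. exact: ratr_natr 0%N. Qed.

Lemma on_curveE x y : on_curve E (Some (x, y)) <-> y ^+ 2 + A * y = x ^+ 3 + B.
Proof. by rewrite /= ratr0 def_A def_B !mul0r !addr0. Qed.

Lemma E0E x y : E0 E v (Some (x, y)) =
  ~~ vge x 0 || ~~ (vge (2 * y + A) 1 && vge (3 * x ^+ 2) 1).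
Proof. by rewrite /= ratr0 def_A !(mul0r, mulr0, addr0, subr0). Qed.

Lemma enegE x y : eneg E (Some (x, y)) = Some (x, - y - A).
Proof. by rewrite /= ratr0 def_A mul0r subr0. Qed.

Lemma eaddE x1 y1 x2 y2 : eadd E (Some (x1, y1)) (Some (x2, y2)) =
  if (x1 == x2) && (y1 + y2 + A == 0) then None else
  let l := if x1 == x2 then 3 * x1 ^+ 2 / (2 * y1 + A) else (y2 - y1) / (x2 - x1) in
  let x3 := l ^+ 2 - x1 - x2 in Some (x3, - l * x3 - (y1 - l * x1) - A).
Proof. by rewrite /= ratr0 def_A !(mul0r, mulr0, addr0, subr0). Qed.

(* At 2 the partial derivative in [x] does not vanish, elsewhere the one in [y]. *)
Lemma E0_unit x y : vge x 0 -> ~~ vge x 1 -> ~~ vge y 1 -> vge A 1 ->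
  E0 E v (Some (x, y)).
Proof.
move=> x0 x1 y1 A1; rewrite E0E x0 /= vgeDl //; apply/negP => /andP[].
have [p2|p2] := eqVneq p 2%N.
  by rewrite (@vge_nat_unit 3) ?p2 // => _ /vge_square; apply/negP.
rewrite vge_nat_unit ?(negPf y1) // prime_coprime // dvdn_prime2 //.
Qed.

(** This is the sum of two points above the cusp when their chord has slope [l]. For a unit [l] it
    reduces to [(l^2, -l^3)], a smooth point of [y^2 = x^3]; for a nonintegral [l] its abscissa is
    nonintegral too. *)
Lemma E0_chord l x1 y1 x2 : vge A 1 -> vge x1 1 -> vge x2 1 -> vge y1 1 -> ~~ vge l 1 ->
  E0 E v (Some (l ^+ 2 - x1 - x2, - l * (l ^+ 2 - x1 - x2) - (y1 - l * x1) - A)).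
Proof.
move=> A1 x11 x21 y11 l1; set x3 := _ - x2.
have x12 : vge (x1 + x2) 1 by rewrite vgeD.
have ex3 : x3 = l ^+ 2 - (x1 + x2) by rewrite /x3; ring.
have [l0|l0] := boolP (vge l 0); last first.
  suff x30 : ~~ vge x3 0 by rewrite E0E x30.
  rewrite ex3 vgeDl; last by rewrite vgeN; apply: vge_le x12.
  by apply: contra l0 => l2; apply: (vgeX_root _ 0 1); apply: vge_le l2.
apply: E0_unit => //.
- by rewrite ex3 vgeB ?vgeX0 //; apply: vge_le x12.
- by rewrite ex3 vgeDl ?vgeN //; apply: contra l1; apply: vge_square.
- rewrite vgeDl ?vgeN // vgeDl; last by rewrite vgeN vgeB // vgeMl.
  rewrite mulNr vgeN vgeM_unit // ex3 vgeDl ?vgeN //.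
  by apply: contra l1; apply: vge_square.
Qed.

(** The reduced curve is [y^2 = x^3]. The derivative in [x] is blind at 3 and the one in [y] is
    blind at 2, so one coordinate comes from a derivative and the other from the equation. *)
Lemma singular_origin x y : vge A 1 -> vge B 1 -> on_curve E (Some (x, y)) ->
  ~~ E0 E v (Some (x, y)) -> vge x 1 /\ vge y 1.
Proof.
move=> A1 B1 /on_curveE xy; rewrite E0E negb_or !negbK vgeDl // => /and3P[x0 y1 x1].
have [p3|p3] := eqVneq p 3%N.
  have y1' : vge y 1 by move: y1; rewrite (@vge_nat_unit 2) ?p3.
  split=> //; apply: vge_cube; rewrite -(vgeDl _ B) // -xy expr2 -mulrDl vgeMr //.
    by rewrite vgeD.
  by apply: vge_le y1'.
have x1' : vge x 1.
  by apply: vge_square; move: x1; rewrite vge_nat_unit // prime_coprime // dvdn_prime2.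
split=> //; have : vge (y * (y + A)) (0 + 0 + 1).
  by rewrite mulrDr -expr2 [y * A]mulrC xy vgeD // (vge_le _ _ _ _ (vgeX _ _ 3 x1')).
by case/vge_factor/orP; rewrite ?vgeDl.
Qed.

Lemma index1 : (forall x y, on_curve E (Some (x, y)) -> E0 E v (Some (x, y))) -> index_is E v 1.
Proof.
move=> E0E; exists [:: None]; split=> //; first by case.
  by case=> [[x y]|] onP; exists 0%N; split=> //; apply: E0E.
by case=> [|i] [].
Qed.

Lemma not_E0_origin x y : vge A 1 -> vge x 1 -> vge y 1 -> ~~ E0 E v (Some (x, y)).
Proof.
move=> A1 x1 y1; rewrite E0E negb_or !negbK vgeDl // expr2 (vge_le 0 1) //=.
by rewrite !vgeMl ?vge_nat // (vge_le 0 1).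
Qed.

(* The curve is [(y - Y1) (y - Y2) = x ^+ 3 - x0 ^+ 3]: a point with singular reduction
   satisfies [y = Yi] to a higher precision than [Y1 - Y2] for one [i], and then the chord
   through this point and [- (x0, Yi)] does not have an integral slope divisible by [p]. *)
Lemma index3 (x0 Y1 Y2 : K) (n : int) :
    A = - (Y1 + Y2) -> B = - (x0 ^+ 3 + Y1 * Y2) -> n = 1 \/ n = 2 ->
    vge Y1 n -> vge Y2 n -> ~~ vge (Y1 - Y2) (n + 1) -> vge x0 1 -> vge (3 * x0) 2 ->
  index_is E v 3.
Proof.
move=> eA eB n12 vY1 vY2 vY x01 x02.
have n1 : 1 <= n by lia.
have A1 : vge A 1 by rewrite eA vgeN (vge_le _ n) // vgeD.
have onT y : y = Y1 \/ y = Y2 -> on_curve E (Some (x0, y)).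
  by move=> yE; apply/on_curveE; rewrite eA eB; case: yE => ->; ring.
have B1 : vge B 1.
  have x03 := vgeX _ _ 3 x01; rewrite eB vgeN vgeD ?(vge_le _ _ _ _ x03) //.
  by apply: vge_le (vgeM _ _ _ _ vY1 vY2); lia.
have near x y : on_curve E (Some (x, y)) -> ~~ E0 E v (Some (x, y)) ->
    vge (x - x0) n /\ (vge (y - Y1) (n + 1) || vge (y - Y2) (n + 1)).
  move=> onP singP; have [x1 y1] := singular_origin _ _ A1 B1 onP singP.
  have e : (y - Y1) * (y - Y2) =
      (x - x0) * ((x - x0) ^+ 2 + 3 * x0 * (x - x0) + 3 * x0 * x0).
    have -> : (y - Y1) * (y - Y2) = y ^+ 2 + A * y + Y1 * Y2 by rewrite eA; ring.
    by move/on_curveE: onP => ->; rewrite eB; ring.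
  set d := x - x0 in e *; set r := 3 * x0 * d + 3 * x0 * x0.
  have d1 : vge d 1 by rewrite vgeB.
  have r3 : vge r 3 by rewrite vgeD // (vgeM _ _ 2 1).
  have {}e : (y - Y1) * (y - Y2) = d * (d ^+ 2 + r) by rewrite e /r; ring.
  (* For [n = 1] the product has valuation at least 1 + 2 = 3, which is the bound [n + n + 1] of
     [vge_factor]. *)
  case: n12 => n12; rewrite n12 in vY1 vY2 *.
    split=> //; apply: vge_factor; rewrite e (vgeM _ _ 1 2) // vgeD ?(vgeX _ _ 2 d1) //.
    by apply: vge_le r3.
  (* For [n = 2] the precision is raised in turns: valuation 3 of the product gives [y] valuation 2,
     so the product has valuation 4; as [d * r] does too, [d ^+ 3] has valuation at least 4 and [d]
     at least 2, whence 5 for the product. *)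
  have y2 : vge y 2.
    have : vge ((y - Y1) * (y - Y2)) (1 + 1 + 1).
      rewrite e (vgeM _ _ 1 2) // vgeD ?(vgeX _ _ 2 d1) //.
      by apply: vge_le r3.
    by case/vge_factor/orP; rewrite vgeDl // vgeN.
  have d2 : vge d 2.
    apply: (vgeX_root _ _ 2); rewrite -(vgeDl _ (d * r)) ?(vgeM _ _ 1 3) //.
    by rewrite (_ : _ + _ = d * (d ^+ 2 + r)) -?e ?(vgeM _ _ 2 2) ?vgeB // e; ring.
  split=> //; apply: vge_factor; rewrite e (vgeM _ _ 2 3) // vgeD //.
  by apply: vge_le (vgeX _ _ 2 d2).
have close Y Y' x y : (Y = Y1 /\ Y' = Y2) \/ (Y = Y2 /\ Y' = Y1) ->
    on_curve E (Some (x, y)) -> ~~ E0 E v (Some (x, y)) -> vge (y - Y) (n + 1) ->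
    E0 E v (eadd E (Some (x, y)) (eneg E (Some (x0, Y)))).
  move=> YY' onP singP yY; have [xn _] := near _ _ onP singP.
  have [x1 y1] := singular_origin _ _ A1 B1 onP singP.
  have eY' : - Y - A = Y' by rewrite eA; case: YY' => -[-> ->]; ring.
  have yY' : ~~ vge (y - Y') (n + 1).
    rewrite (_ : y - Y' = (y - Y) + (Y - Y')); last by rewrite addrA subrK.
    by rewrite vgeDr //; case: YY' => -[-> ->] //; rewrite -vgeN opprB.
  rewrite enegE eY' eaddE; case: eqVneq => [xx0|xx0] /=.
    have : (y - Y1) * (y - Y2) = 0.
      have -> : (y - Y1) * (y - Y2) = y ^+ 2 + A * y + Y1 * Y2 by rewrite eA; ring.
      by move/on_curveE: onP => ->; rewrite eB xx0; ring.
    have y'0 : y - Y' != 0 by apply: contraNneq yY' => ->; rewrite vge0.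
    have yYY' : (y - Y1) * (y - Y2) = (y - Y') * (y - Y) by case: YY' => -[-> ->]; ring.
    rewrite yYY' => /eqP; rewrite mulf_eq0 (negPf y'0) subr_eq0 /= => /eqP->.
    by rewrite -eY' addrA subrr sub0r addNr eqxx.
  (* If [p] divided the slope, then [y - Y'], the slope times [x - x0], would have valuation at
     least [n + 1]. *)
  apply: E0_chord => //; apply: contra yY' => l1.
  have -> : y - Y' = (Y' - y) / (x0 - x) * (x - x0).
    by field; rewrite subr_eq0 eq_sym.
  by rewrite [n + 1]addrC vgeM.
have YY0 : Y1 - Y2 != 0 by apply: contraNneq vY => ->; rewrite vge0.
(* This separates the two nontrivial classes. The difference is the double of [(x0, Y)], and its
   tangent slope [3 x0 ^+ 2 / (Y - Y')] has valuation at least [3 - n >= 1], so the double is still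
   above the cusp. *)
have double Y Y' : (Y = Y1 /\ Y' = Y2) \/ (Y = Y2 /\ Y' = Y1) ->
    ~~ E0 E v (eadd E (Some (x0, Y)) (eneg E (Some (x0, Y')))).
  move=> YY'; rewrite enegE eaddE eqxx /=.
  have -> : - Y' - A = Y by rewrite eA; case: YY' => -[-> ->]; ring.
  have eY : Y + Y + A = Y - Y' by rewrite eA; case: YY' => -[-> ->]; ring.
  have Y0 : Y - Y' != 0 by case: YY' => -[-> ->] //; rewrite -opprB oppr_eq0.
  have vYn : ~~ vge (Y - Y') (n + 1) by case: YY' => -[-> ->] //; rewrite -vgeN opprB.
  rewrite eY (negPf Y0) (_ : 2 * Y + A = Y - Y'); last by rewrite -eY; ring.
  set l := _ / _.
  have l3 : vge (l * (Y - Y')) 3.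
    by rewrite /l divfK // expr2 mulrA (vgeM _ _ 2 1).
  have l1 : vge l 1.
    apply: (vge_le _ (3 - n)); first by case: n12 => ->.
    by apply: vge_cancel vYn; rewrite subrK.
  have vYm : vge Y 1 by apply: (vge_le _ n) => //; case: YY' => -[-> _].
  have l21 : vge (l ^+ 2) 1 by apply: vge_le (vgeX _ _ 2 l1).
  have x31 : vge (l ^+ 2 - x0 - x0) 1 by rewrite !vgeB.
  have l0 : vge l 0 by apply: vge_le l1.
  apply: not_E0_origin => //; apply: vgeB => //; apply: vgeB; last by rewrite vgeB // vgeMl.
  by rewrite mulNr vgeN vgeMl.
exists [:: None; Some (x0, Y1); Some (x0, Y2)]; split=> //.
- by case=> [|[|[|]]] //= _; apply: onT; [left | right].
- case=> [[x y]|] onP; last by exists 0%N.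
  have [?|singP] := boolP (E0 E v (Some (x, y))); first by exists 0%N.
  have [_ /orP[?|?]] := near _ _ onP singP.
    by exists 1%N; split=> //; apply: (close Y1 Y2) => //; left.
  by exists 2%N; split=> //; apply: (close Y2 Y1) => //; right.
have eN1 : eneg E (Some (x0, Y1)) = Some (x0, Y2) by rewrite enegE eA; congr (Some (_, _)); ring.
have eN2 : eneg E (Some (x0, Y2)) = Some (x0, Y1) by rewrite enegE eA; congr (Some (_, _)); ring.
have sing1 := not_E0_origin x0 _ A1 x01 (vge_le _ _ _ n1 vY1).
have sing2 := not_E0_origin x0 _ A1 x01 (vge_le _ _ _ n1 vY2).
have d12 := double Y1 Y2 (or_introl (conj erefl erefl)).
have d21 := double Y2 Y1 (or_intror (conj erefl erefl)).
case=> [|[|[|i]]] [|[|[|j]]] // _ _; rewrite [nth _ _ _]/= [nth _ _ _]/=.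
- by rewrite eN1 (negPf sing2).
- by rewrite eN2 (negPf sing1).
- by rewrite (negPf sing1).
- by rewrite (negPf d12).
- by rewrite (negPf sing2).
- by rewrite (negPf d21).
Qed.

Lemma vge3M x n : p = 3%N -> vge (3 * x) n = vge x (n - 1).
Proof. by move=> p3; rewrite vge_natM // p3. Qed.

(* [(x0, 0)] is a 2-torsion point with singular reduction. Translation by it sends [x] to
   [x0 + 3 x0 ^+ 2 / (x - x0)], which is either not integral or not congruent to [x0]. *)
Lemma index2 (x0 : K) (b : int) :
    p = 3%N -> A = 0 -> B = - x0 ^+ 3 -> b = 0 \/ b = 1 -> vge x0 b -> ~~ vge x0 (b + 1) ->
  index_is E v 2.
Proof.
move=> p3 A0 eB b01 x0b x0b1.
have v3 : vge 3 1 by have := vge_p; rewrite p3.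
have x00 : vge x0 0 by apply: vge_le x0b; case: b01 => ->.
(* The valuation of [3 x0 ^+ 2] is exactly [2 b + 1]; all contradictions below come from exceeding
   it. *)
have vx0 : ~~ vge (3 * x0 ^+ 2) (b + b + 2).
  rewrite vge3M //; apply: contra x0b1 => h; apply: (vgeX_root _ _ 1).
  by apply: vge_le h; case: b01 => ->.
have eT : eneg E (Some (x0, 0)) = Some (x0, 0) by rewrite enegE A0 !subr0 oppr0.
have singT : ~~ E0 E v (Some (x0, 0)).
  by rewrite E0E A0 mulr0 add0r x00 vge0 /= negbK vgeMr // vgeX0.
have onT : on_curve E (Some (x0, 0)).
  by apply/on_curveE; rewrite A0 eB expr0n mul0r addr0 subrr.
have subT x y : on_curve E (Some (x, y)) -> ~~ E0 E v (Some (x, y)) ->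
    E0 E v (eadd E (Some (x, y)) (eneg E (Some (x0, 0)))).
  move/on_curveE; rewrite A0 mul0r addr0 eB => xy.
  rewrite E0E negb_or !negbK A0 addr0 (@vge_nat_unit 2) ?p3 // => /and3P[xi y1 _].
  rewrite eT eaddE A0 !addr0; set d := x - x0.
  have di : vge d 0 by rewrite vgeB.
  have ed : d ^+ 3 = y ^+ 2 - (3 * (x0 * d ^+ 2) + 3 * x0 ^+ 2 * d) by rewrite xy /d; ring.
  have d1 : vge d 1.
    apply: vge_cube; rewrite ed vgeB //; first by apply: vge_le (vgeX _ _ 2 y1).
    by rewrite vgeD // ?vgeMr // ?vgeMl // ?vgeX0 // vgeMr // vgeX0.
  (* For [b = 1], valuation 3 of [y ^+ 2] gives [y] valuation 2; then every term of [ed] has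
     valuation at least 4, and so [d] has at least 2. *)
  have db : vge d (b + 1).
    case: b01 => eb; rewrite eb in x0b *; first by [].
    have y2 : vge y 2.
      have := vgeX _ _ 3 d1; rewrite ed vgeDl.
        by move=> y3; apply: (vgeX_root _ _ 1).
      rewrite vgeN vgeD //; first by apply: (vgeM _ _ 1 2) => //; rewrite vgeMl // (vgeX _ _ 2 d1).
      by rewrite -mulrA (vgeM _ _ 1 2) // vgeMr // (vgeX _ _ 2 x0b).
    apply: (vgeX_root _ _ 2); rewrite ed vgeB ?(vgeX _ _ 2 y2) //.
    rewrite vgeD //; first by apply: (vgeM _ _ 1 3) => //; rewrite (vgeM _ _ 1 2) // (vgeX _ _ 2 d1).
    by rewrite -mulrA (vgeM _ _ 1 3) // (vgeM _ _ 2 1) // (vgeX _ _ 2 x0b).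
  case: eqVneq => [xx0|xx0] /=.
    have /eqP : y ^+ 2 = 0 by rewrite xy xx0 subrr.
    by rewrite expf_eq0 /= => /eqP->; rewrite eqxx.
  have d0 : d != 0 by rewrite subr_eq0.
  rewrite sub0r !subr0; set l := - y / _.
  have yE : y = l * d by rewrite /l /d; field; rewrite subr_eq0 eq_sym.
  have lE : l ^+ 2 * d = d ^+ 2 + 3 * (x0 * d) + 3 * x0 ^+ 2.
    by apply: (mulIf d0); rewrite -mulrA -expr2 -exprMn -yE xy /d; ring.
  clearbody l; set x3 := l ^+ 2 - x - x0.
  have x3E : (x3 - x0) * d = 3 * x0 ^+ 2.
    have -> : (x3 - x0) * d = l ^+ 2 * d - (d + 3 * x0) * d by rewrite /x3 /d; ring.
    by rewrite lE; ring.
  (* If 3 divided [l], each term of [lE] other than [3 x0 ^+ 2] would have valuation at least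
     [2 b + 2], as [b <= 1]. *)
  have l1 : ~~ vge l 1.
    apply: contra vx0 => l1.
    have -> : 3 * x0 ^+ 2 = l ^+ 2 * d - (d ^+ 2 + 3 * (x0 * d)) by rewrite lE; ring.
    rewrite vgeB //; first by apply: vge_le (vgeM _ _ _ _ (vgeX _ _ 2 l1) db); case: b01 => ->.
    rewrite vgeD //; first by apply: vge_le (vgeX _ _ 2 db); case: b01 => ->.
    by apply: vge_le (vgeM _ _ _ _ v3 (vgeM _ _ _ _ x0b db)); case: b01 => ->.
  rewrite /= ratr0 def_A !(mul0r, mulr0, addr0, subr0).
  have [x3i|//] := boolP (vge x3 0); rewrite orFb.
  have l0 : vge l 0.
    apply: (vgeX_root _ _ 1); apply: (vge_le _ 0) => //.
    have -> : l ^+ 2 = x3 + x + x0 by rewrite /x3; ring.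
    by rewrite vgeD // vgeD.
  (* Now [l] is a unit, so [d] inherits the valuation of the right-hand side of [lE]. *)
  have dn : vge d (b + b + 1).
    rewrite -(vgeM_unit l) // -(vgeM_unit l) // mulrA -expr2 lE vgeD //.
      rewrite vgeD //; first by apply: vge_le (vgeX _ _ 2 db); case: b01 => ->.
      by apply: vge_le (vgeM _ _ _ _ v3 (vgeM _ _ _ _ x0b db)); case: b01 => ->.
    by rewrite vge3M //; apply: vge_le (vgeX _ _ 2 x0b); case: b01 => ->.
  rewrite A0 addr0 (@vge_nat_unit 2) ?p3 //.
  (* The ordinate of the sum is [- l (x3 - x0)], so singular reduction forces 3 to divide [x3 - x0],
     and [x3E] then makes [3 x0 ^+ 2] too divisible. *)
  rewrite (_ : _ - _ = - (l * (x3 - x0))); last by rewrite yE /d; ring.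
  rewrite vgeN (vgeM_unit l) //; apply/negP => /andP[x31 _].
  move: vx0; rewrite -x3E => /negP; apply.
  by apply: vge_le (vgeM _ _ _ _ x31 dn); case: b01 => ->.
exists [:: None; Some (x0, 0)]; split=> //.
- by case=> [|[|]].
- case=> [[x y]|] onP; last by exists 0%N.
  have [?|singP] := boolP (E0 E v (Some (x, y))); first by exists 0%N.
  by exists 1%N; split=> //; apply: subT.
case=> [|[|i]] [|[|j]] // _ _; rewrite [nth _ _ _]/= [nth _ _ _]/=.
  by rewrite eT (negPf singT).
by rewrite (negPf singT).
Qed.

(** At 3 the derivative in [x] always vanishes modulo 3, so an integral point reduces to a singular
    one exactly when 3 divides [y]. *)
Lemma index1_at3 : p = 3%N -> A = 0 ->
    (forall x y, vge x 0 -> vge y 1 -> y ^+ 2 = x ^+ 3 + B -> False) ->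
  index_is E v 1.
Proof.
move=> p3 A0 no_sing; apply: index1 => x y /on_curveE; rewrite A0 mul0r addr0 => xy.
apply: contraT; rewrite E0E negb_or !negbK A0 addr0 (@vge_nat_unit 2) ?p3 //.
by case/and3P=> x0 y1 _; case: (no_sing x y).
Qed.

End CubicModel.

(** * Residues modulo 9 and discriminants of cubic models *)

Lemma vge_natB m n k : vge (m%:R - n%:R) k%:Z = (m == n %[mod p ^ k])%N.
Proof.
wlog le_nm : m n / (n <= m)%N => [IH|].
  have [/IH//|/ltnW/IH] := leqP n m.
  by rewrite -vgeN opprB eq_sym.
by rewrite -natrB // pmulrn vge_intE eqn_mod_dvd.
Qed.

(** Cubing gains a 3-adic digit: with [x = k + t] the difference is [3 t k (k + t) + t ^+ 3]. *)
Lemma cube_residue x : p = 3%N -> vge x 0 -> exists k : nat, vge (x ^+ 3 - k%:R ^+ 3) 2.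
Proof.
move=> p3 x0; have [k xk] := residue _ x0; exists k; set t := _ - _ in xk.
have t0 : vge t 0 by apply: vge_le xk.
have -> : x ^+ 3 - k%:R ^+ 3 = 3 * (t * (k%:R * (k%:R + t))) + t ^+ 3 by rewrite /t; ring.
rewrite vgeD //; last by apply: vge_le (vgeX _ _ 3 xk).
rewrite vge3M //; apply: vgeMr; last by integral.
exact: xk.
Qed.

Lemma cube_root1 c : p = 3%N -> vge (c - 1) 2 -> exists2 x, vge (x - 1) 1 & x ^+ 3 = c.
Proof.
move=> p3 c1; have n9 := nat_neq0 9 isT.
have d0 : vge ((c - 1) / 9) 0.
  by move: c1; rewrite -{1}(divfK n9 (c - 1)) mulrC vge_natM // p3.
have [x x1 ex] := cube_root _ p3 d0; exists x => //.
by rewrite ex mulrC divfK // addrC subrK.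
Qed.

Lemma vpM q r : q != 0 -> r != 0 -> vp p (q * r) = vp p q + vp p r.
Proof. by move=> q0 r0; rewrite -!v_ratr ?mulf_neq0 // ratrM vM ?ratr_eq0. Qed.

Lemma vp_nat n : (0 < n)%N -> vp p n%:R = (logn p n)%:Z.
Proof. by move=> n0; rewrite -v_ratr ?pnatr_eq0 -?lt0n // ratr_natr v_nat. Qed.

Lemma vpN q : vp p (- q) = vp p q.
Proof.
have [->|q0] := eqVneq q 0; first by rewrite oppr0.
by rewrite -!v_ratr ?oppr_eq0 // ratrN vN.
Qed.

Lemma disc_cubic (a3 a6 : rat) :
  disc (cubic_model a3 a6) = - (27%:R * ((a3 ^+ 2 + 4 * a6) * (a3 ^+ 2 + 4 * a6))).
Proof. by rewrite /disc /=; ring. Qed.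

Lemma vp_disc_cubic a3 a6 D : a3 ^+ 2 + 4 * a6 = D -> D != 0 ->
  disc (cubic_model a3 a6) != 0 /\
  vp p (disc (cubic_model a3 a6)) = (logn p 27)%:Z + (vp p D + vp p D).
Proof.
move=> eD D0; rewrite disc_cubic eD oppr_eq0 vpN !vpM ?mulf_neq0 //.
by rewrite vp_nat.
Qed.

Lemma wint_cubic a3 a6 : vge (ratr a3) 0 -> vge (ratr a6) 0 -> wint p (cubic_model a3 a6).
Proof. by move=> v3 v6; rewrite /wint !pintE /= ratr0 !vge0 v3 v6. Qed.

Lemma c4_cubic a3 a6 : c4 (cubic_model a3 a6) = 0.
Proof. by rewrite /c4 /b2 /b4 /=; ring. Qed.

Lemma tamagawa_minimal E E' c : isoQ E E' -> p_minimal p E' -> index_is E' v c ->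
  tamagawa p K v E c.
Proof. by exists E'. Qed.

(** * The two curves: models, minimality, and indices at primes dividing [a] *)

Section Curves.
Variable a : nat.
Hypothesis a_gt0 : (0 < a)%N.
Let al : K := a%:R.

(** Completing the square, which keeps the model integral at 3. *)
Lemma EC3_short_iso : isoQ (EC3 a) (cubic_model 0 (a%:R ^+ 2 / 4)).
Proof.
exists 1, 0, 0, (- (a%:R / 2)); split; first exact: oner_neq0.
by rewrite /change /=; congr WModel; field.
Qed.

Lemma EC3t_short_iso : isoQ (EC3t a) (cubic_model 0 (- (27 * a%:R ^+ 2 / 4))).
Proof.
exists 1, 0, 0, (- (a%:R / 2)); split; first exact: oner_neq0.
by rewrite /change /=; congr WModel; field.
Qed.

(** For use at 3 when 9 divides [a] exactly twice-divisible, i.e. [logn p a = 2]: the discriminant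
    of [EC3t a] then has valuation 17, and scaling by 3 lowers it to 5. *)
Lemma EC3t_scaled_iso : isoQ (EC3t a) (cubic_model 0 (- (a%:R ^+ 2 / 108))).
Proof.
exists 3, 0, 0, (- (a%:R / 2)); split; first by [].
by rewrite /change /=; congr WModel; field.
Qed.

Lemma aQ_neq0 : a%:R != 0 :> rat. Proof. by rewrite pnatr_eq0 -lt0n. Qed.

Lemma EC3_disc : disc (EC3 a) != 0 /\
  vp p (disc (EC3 a)) = (logn p 27)%:Z + 4 * (logn p a)%:Z.
Proof.
have [|//|-> ->] := vp_disc_cubic a%:R 0 (a%:R * a%:R); first by ring.
  by rewrite mulf_neq0 ?aQ_neq0.
by rewrite vpM ?aQ_neq0 // vp_nat //; split=> //; lia.
Qed.

Lemma EC3t_disc : disc (EC3t a) != 0 /\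
  vp p (disc (EC3t a)) = 3 * (logn p 27)%:Z + 4 * (logn p a)%:Z.
Proof.
have [||-> ->] := vp_disc_cubic a%:R (- 7 * a%:R ^+ 2) (- (27%:R * (a%:R * a%:R))); first by ring.
  by rewrite oppr_eq0 !mulf_neq0 ?aQ_neq0.
by rewrite vpN !vpM ?mulf_neq0 ?aQ_neq0 // !vp_nat //; split=> //; lia.
Qed.

Lemma EC3_wint : wint p (EC3 a).
Proof. by rewrite wint_cubic ?ratr_natr ?ratr0 ?vge_nat ?vge0. Qed.

Lemma EC3t_wint : wint p (EC3t a).
Proof.
apply: wint_cubic; rewrite !ratrE; integral.
Qed.

Lemma logn27 : logn p 27 = (if p == 3%N then 3 else 0)%N.
Proof. by rewrite (lognX p 3 3) logn_prime //; case: eqP. Qed.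

Lemma al_neq0 : al != 0. Proof. exact: nat_neq0. Qed.

Lemma vge_al n : vge al n = (n <= (logn p a)%:Z).
Proof. by rewrite vgeE ?al_neq0 // v_nat. Qed.

(** The discriminant [-27 a^4] has valuation at most 3 + 8 = 11. *)
Lemma EC3_minimal : (logn p a <= 2)%N -> p_minimal p (EC3 a).
Proof.
have [d0 ed] := EC3_disc => le2; apply: minimal_lt12; [exact: EC3_wint | exact: d0 |].
by rewrite ed logn27; case: eqP; lia.
Qed.

Lemma EC3t_minimal : p != 3%N -> (logn p a <= 2)%N -> p_minimal p (EC3t a).
Proof.
have [d0 ed] := EC3t_disc => p3 le2; apply: minimal_lt12; [exact: EC3t_wint | exact: d0 |].
by rewrite ed logn27 (negPf p3); lia.
Qed.

Lemma dvd_logn : (p %| a)%N -> (logn p a <= 2)%N ->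
  (logn p a)%:Z = 1 \/ (logn p a)%:Z = 2.
Proof. by move=> pa le2; have := logn_gt0 p a; rewrite mem_primes p_prime a_gt0 pa /=; lia. Qed.

(** The 3-torsion points [(0, 0)] and [(0, -a)] represent the nontrivial classes. *)
Lemma EC3_index3 : (p %| a)%N -> (logn p a <= 2)%N -> index_is (EC3 a) v 3.
Proof.
move=> pa le2; apply: (index3 a%:R 0 al 0 _ _ 0 0 (- al) (logn p a)%:Z) => //.
- exact: ratr_natr.
- exact: ratr0.
- by rewrite add0r opprK.
- by rewrite mul0r expr0n addr0 oppr0.
- exact: dvd_logn.
- exact: vge0.
- by rewrite vgeN vge_al.
- by rewrite sub0r opprK vge_al; lia.
- exact: vge0.
- by rewrite mulr0 vge0.
Qed.

(** For a primitive cube root of unity [w], the roots of [Y^2 + a Y + 7 a^2] are [a (1 + 3 w)] and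
    [a (-2 - 3 w)]. They differ by [3 (2 w + 1) a], of the same valuation as [a], because
    [(2 w + 1)^2 = -3] is a unit. *)
Lemma EC3t_index3 : p != 3%N -> (p %% 3 = 1)%N -> (p %| a)%N -> (logn p a <= 2)%N ->
  index_is (EC3t a) v 3.
Proof.
move=> p3 p1 pa le2; have co3 : coprime p 3 by rewrite prime_coprime // dvdn_prime2.
have [k /vge_dvd] := exists_order3 p p_prime p1; rewrite natrD natrD natrX => vk.
have sq (w : K) : (2 * w + 1) ^+ 2 = 4 * (w ^+ 2 + w + 1) - 3 by ring.
have [w w0 ew] : exists2 w, vge w 0 & w ^+ 2 + w + 1 = 0.
  apply: (quadratic_root k%:R) => //; first exact: vge_nat.
  apply: contra (coprime_vge _ co3) => v2k.
  have -> : 3 = 4 * (k%:R ^+ 2 + k%:R + 1) - (2 * k%:R + 1) ^+ 2 :> K by rewrite sq; ring.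
  apply: vgeB; first by apply: vgeMl vk; exact: vge_nat.
  exact: vge_le (vgeX _ _ 2 v2k).
have w21 : ~~ vge (2 * w + 1) 1.
  apply: contra (coprime_vge _ co3) => v2w.
  have -> : 3 = - (2 * w + 1) ^+ 2 :> K by rewrite sq ew; ring.
  by rewrite vgeN; exact: vge_le (vgeX _ _ 2 v2w).
have n12 := dvd_logn pa le2.
apply: (index3 a%:R (- 7 * a%:R ^+ 2) al (- 7 * al ^+ 2) _ _
   0 (al * (1 + 3 * w)) (al * (- 2 - 3 * w)) (logn p a)%:Z) => //.
- exact: ratr_natr.
- by rewrite !ratrE.
- by ring.
- have -> : - (0 ^+ 3 + al * (1 + 3 * w) * (al * (- 2 - 3 * w))) =
     al ^+ 2 * (9 * (w ^+ 2 + w + 1) - 7) by ring.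
  by rewrite ew; ring.
- by apply: vgeMr; rewrite ?vge_al //; integral.
- by apply: vgeMr; rewrite ?vge_al //; integral.
- have -> : al * (1 + 3 * w) - al * (- 2 - 3 * w) = 3 * ((2 * w + 1) * al) by ring.
  rewrite vge_nat_unit // vgeM_unit //; last by integral.
  by rewrite vge_al; lia.
- exact: vge0.
- by rewrite mulr0 vge0.
Qed.

(** At a singular point [x ^+ 3] has valuation above that of [a ^+ 2], so dividing
    [y^2 + a y + 7 a^2 = x^3] by [a^2] makes [y / a] a root of [u^2 + u + 7] modulo [p], against
    [no_root_2mod3]. *)
Lemma EC3t_index1 : p != 3%N -> (p %% 3 = 2)%N -> (p %| a)%N -> (logn p a <= 2)%N ->
  index_is (EC3t a) v 1.
Proof.
move=> p3 p2 pa le2; have n12 := dvd_logn pa le2.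
have defA : ratr a%:R = al by exact: ratr_natr.
have defB : ratr (- 7 * a%:R ^+ 2) = - 7 * al ^+ 2 by rewrite !ratrE.
have al1 : vge al 1 by rewrite vge_al; lia.
have B2 : vge (- 7 * al ^+ 2) 2 by rewrite mulNr vgeN vgeMl ?vge_nat // (vgeX _ _ 2 al1).
apply: index1 => x y onP; apply: contraT => singP.
have [x1 y1] := singular_origin _ _ _ _ defA defB _ _ al1 (vge_le 1 2 _ isT B2) onP singP.
move/(on_curveE _ _ _ _ defA defB): onP => xy.
have {}xy : y ^+ 2 + al * y + 7 * al ^+ 2 = x ^+ 3 by rewrite xy; ring.
have [yn xn] : vge y (logn p a)%:Z /\ vge (x ^+ 3) ((logn p a)%:Z *+ 2 + 1).
  case: n12 => n12; rewrite n12; first by split=> //; apply: vgeX x1.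
  have al2 : vge al 2 by rewrite vge_al n12.
  have y2 : vge y 2.
    apply: (vgeX_root _ _ 1).
    have -> : y ^+ 2 = x ^+ 3 - (al * y + 7 * al ^+ 2) by rewrite -xy; ring.
    apply: vgeB (vgeX _ _ 3 x1) _; apply: vgeD (vgeM _ _ 2 1 al2 y1) _.
    by apply: vgeMl; [exact: vge_nat | exact: vge_le (vgeX _ _ 2 al2)].
  split=> //.
  have x2 : vge x 2.
    apply: (vgeX_root _ _ 2); rewrite -xy; apply: vgeD (vgeMl _ _ _ (vge_nat 7) (vgeX _ _ 2 al2)).
    exact: vgeD (vgeX _ _ 2 y2) (vgeM _ _ 2 2 al2 y2).
  by apply: vge_le (vgeX _ _ 3 x2).
have valE : v al = (logn p a)%:Z by rewrite v_nat.
pose u := y / al; have yE : y = u * al by rewrite divfK ?al_neq0.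
have u0 : vge u 0.
  by apply: (vge_cancel _ al _ (logn p a)%:Z); rewrite ?add0r -?yE // vge_al; clear; lia.
have u1 : vge (u ^+ 2 + u + 7) 1.
  have : vge ((u ^+ 2 + u + 7) * al ^+ 2) (1 + (logn p a)%:Z *+ 2).
    by rewrite (_ : _ * _ = x ^+ 3) ?[1 + _]addrC // -xy yE; ring.
  move/vge_cancel; apply; rewrite vgeE ?expf_neq0 ?al_neq0 // vX ?al_neq0 // valE.
  by clear; lia.
have [k uk] := residue _ u0.
have : vge (k ^ 2 + k + 7)%:R 1.
  have -> : (k ^ 2 + k + 7)%:R = (u ^+ 2 + u + 7) - (u - k%:R) * (u + k%:R + 1) :> K.
    by rewrite !natrD natrX; ring.
  by rewrite vgeB // vgeMr //; integral.
by rewrite pmulrn (vge_intE _ 1) expn1 (negPf (no_root_2mod3 _ k p_prime p2)).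
Qed.

(** * The prime 3 *)

Section At3.
Hypothesis p3 : p = 3%N.

Lemma two_neq0 : 2 != 0 :> K. Proof. exact: nat_neq0. Qed.

Lemma vge_inv k x n : (0 < k)%N -> vge (x / k%:R) n = vge x (n + (logn p k)%:Z).
Proof.
move=> k0; rewrite -[X in _ = vge X _](divfK (nat_neq0 _ k0)) [X in _ = vge X _]mulrC.
by rewrite vge_natM // addrK.
Qed.

Lemma vge_quarter x n : vge (x / 4) n = vge x n.
Proof. by rewrite vge_inv // logn_coprime ?addr0 // p3. Qed.

Lemma logn3_27 : logn p 27 = 3%N. Proof. by rewrite p3. Qed.

Lemma coprime3 : ~~ (3 %| a)%N -> coprime p a.
Proof. by rewrite p3 prime_coprime. Qed.

Lemma vge_sq_al n : vge (al ^+ 2) n = (n <= (logn p a)%:Z *+ 2).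
Proof. by rewrite vgeE ?expf_neq0 ?al_neq0 // vX ?al_neq0 // v_nat. Qed.

Lemma ratr_EC3_a6 : ratr (a%:R ^+ 2 / 4) = al ^+ 2 / 4.
Proof. by rewrite ratrM ratrX ratrV !ratr_natr. Qed.

Lemma ratr_EC3t_a6 : ratr (- (27 * a%:R ^+ 2 / 4)) = - (27 * al ^+ 2 / 4).
Proof. by rewrite ratrN ratrM ratrV ratrM ratrX !ratr_natr. Qed.

Lemma ratr_EC3t_scaled_a6 : ratr (- (a%:R ^+ 2 / 108)) = - (al ^+ 2 / 108).
Proof. by rewrite ratrN ratrM ratrX ratrV !ratr_natr. Qed.

Lemma rat27_neq0 : 27%:R != 0 :> rat. Proof. by rewrite pnatr_eq0. Qed.

Lemma EC3_short_minimal : ~~ (3 %| a)%N -> p_minimal p (cubic_model 0 (a%:R ^+ 2 / 4)).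
Proof.
move=> a3; have [||d0 ed] := vp_disc_cubic 0 (a%:R ^+ 2 / 4) (a%:R * a%:R).
- by field.
- by rewrite mulf_neq0 ?aQ_neq0.
apply: (minimal_c4 _ p3 _ d0 (c4_cubic _ _)).
  apply: wint_cubic; first by rewrite ratr0 vge0.
  by rewrite ratr_EC3_a6 vge_quarter vgeX0 ?vge_nat.
by rewrite ed vpM ?aQ_neq0 // vp_nat // (logn_coprime (coprime3 a3)) logn27 p3.
Qed.

(** The discriminant has valuation 9 or 13; the latter requires the sharper criterion
    [minimal_c4]. *)
Lemma EC3t_short_minimal : (logn p a <= 1)%N -> p_minimal p (cubic_model 0 (- (27 * a%:R ^+ 2 / 4))).
Proof.
move=> le1; have [||d0 ed] := vp_disc_cubic 0 (- (27 * a%:R ^+ 2 / 4)) (- (27%:R * (a%:R * a%:R))).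
- by field.
- by rewrite oppr_eq0 (mulf_neq0 rat27_neq0 (mulf_neq0 aQ_neq0 aQ_neq0)).
apply: (minimal_c4 _ p3 _ d0 (c4_cubic _ _)).
  apply: wint_cubic; first by rewrite ratr0 vge0.
  by rewrite ratr_EC3t_a6 vgeN vge_quarter; apply: vgeMl; rewrite ?vgeX0 ?vge_nat.
rewrite ed vpN (vpM _ _ rat27_neq0 (mulf_neq0 aQ_neq0 aQ_neq0)) (vpM _ _ aQ_neq0 aQ_neq0).
by rewrite (vp_nat 27 isT) (vp_nat _ a_gt0) logn3_27; move: le1; clear; lia.
Qed.

Lemma EC3t_scaled_minimal : (logn p a = 2)%N -> p_minimal p (cubic_model 0 (- (a%:R ^+ 2 / 108))).
Proof.
move=> eq2; have i27 : 27%:R^-1 != 0 :> rat by rewrite invr_eq0 rat27_neq0.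
have aa := mulf_neq0 aQ_neq0 aQ_neq0.
have [||d0 ed] := vp_disc_cubic 0 (- (a%:R ^+ 2 / 108)) (- (27%:R^-1 * (a%:R * a%:R))).
- by field.
- by rewrite oppr_eq0 (mulf_neq0 i27 aa).
apply: (minimal_c4 _ p3 _ d0 (c4_cubic _ _)).
  apply: wint_cubic; first by rewrite ratr0 vge0.
  rewrite ratr_EC3t_scaled_a6 vgeN (vge_inv 108 _ _ isT) vge_sq_al eq2 (_ : logn p 108 = 3%N) //.
  by rewrite p3.
have v27 : vp p (27%:R^-1) = - (logn p 27)%:Z.
  by rewrite -(v_ratr _ i27) ratrV ratr_natr (vV _ (nat_neq0 27 isT)) (v_nat 27 isT).
rewrite ed vpN (vpM _ _ i27 aa) (vpM _ _ aQ_neq0 aQ_neq0).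
by rewrite v27 (vp_nat _ a_gt0) logn3_27 eq2.
Qed.

Lemma vge_sq_mod (r : nat) : (a ^ 2 = r %[mod 9])%N -> vge (al ^+ 2 - r%:R) 2.
Proof. by move=> /eqP e; rewrite -natrX (vge_natB _ _ 2) p3. Qed.

(** Here [a ^ 2] is 4 modulo 9, so [a ^ 2 / 4] lies in [1 + 9 Z_3]. Its cube root [x] gives the
    2-torsion points [(-x, 0)] and [(3 x, 0)] on the two short models. *)
Lemma cube_root_quarter : (a %% 9 = 2 \/ a %% 9 = 7)%N ->
  exists2 x, vge (x - 1) 1 & x ^+ 3 = al ^+ 2 / 4.
Proof.
move=> a9; apply: cube_root1 => //; rewrite (_ : _ - _ = (al ^+ 2 - 4) / 4).
  rewrite vge_quarter (vge_sq_mod 4) // -modnXm.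
  by case: a9 => ->.
by field; exact: nat_neq0.
Qed.

Lemma vge_sub1 x : vge (x - 1) 1 -> vge x 0 /\ ~~ vge x 1.
Proof.
move=> x1; split.
  by rewrite -(subrK 1 x) vgeD ?vge1 //; apply: vge_le x1.
by rewrite -(subrK 1 x) vgeDr // vgeE ?oner_neq0 // v1.
Qed.

(** A point with 3 dividing [y] would give [4 x^3 + a^2 = 0] modulo 9. *)
Lemma EC3_short_index1 : (a %% 9 \in [:: 1; 8; 4; 5])%N ->
  index_is (cubic_model 0 (a%:R ^+ 2 / 4)) v 1.
Proof.
move=> a9; apply: (index1_at3 _ _ _ _ ratr0 ratr_EC3_a6 p3) => // x y x0 y1 xy.
have [k xk] := cube_residue _ p3 x0.
have : vge (4 * k ^ 3 + a ^ 2)%:R 2.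
  have -> : (4 * k ^ 3 + a ^ 2)%:R = 4 * y ^+ 2 - 4 * (x ^+ 3 - k%:R ^+ 3) :> K.
    have n4 := nat_neq0 4 isT.
    by rewrite xy natrD natrM (natrX _ k 3) (natrX _ a 2); field.
  by rewrite vgeB // vgeMl ?vge_nat // (vgeX _ _ 2 y1).
by rewrite pmulrn (vge_intE _ 2) p3 (negPf (cube_plus_square_mod9 _ k a9)).
Qed.

Lemma EC3_short_index2 : (a %% 9 = 2 \/ a %% 9 = 7)%N ->
  index_is (cubic_model 0 (a%:R ^+ 2 / 4)) v 2.
Proof.
move=> /cube_root_quarter[x /vge_sub1[x0 x1] ex].
apply: (index2 _ _ _ _ ratr0 ratr_EC3_a6 (- x) 0) => //; rewrite ?vgeN //; last by left.
by rewrite -ex; ring.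
Qed.

(** With [x^3 = a^2] the points [(3 x, 9 a / 2)] and [(3 x, -9 a / 2)] are 3-torsion; their
    ordinates differ by [9 a], of valuation exactly 2. *)
Lemma EC3t_short_index3 : (a %% 9 = 1 \/ a %% 9 = 8)%N ->
  index_is (cubic_model 0 (- (27 * a%:R ^+ 2 / 4))) v 3.
Proof.
move=> a9.
have [|x /vge_sub1[x0 _] ex] := cube_root1 (al ^+ 2) p3.
  by apply: (vge_sq_mod 1); rewrite -modnXm; case: a9 => ->.
have al1 : ~~ vge al 1.
  by rewrite coprime_vge // coprime3 //; case: a9 => a9; lia.
have v9 : vge (9 * al / 2) 2 by rewrite vge_inv // vge_natM // p3 vge_nat.
have n2 := two_neq0; have n4 := nat_neq0 4 isT.
apply: (index3 _ _ _ _ ratr0 ratr_EC3t_a6 (3 * x) (9 * al / 2) (- (9 * al / 2)) 2); rewrite ?vgeN //.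
- by rewrite subrr oppr0.
- by rewrite exprMn ex; field; rewrite n2 n4.
- by right.
- rewrite (_ : _ - _ = 9 * al); last by field.
  by rewrite vge_natM // p3.
- by rewrite vge3M.
- by rewrite !vge3M.
Qed.

Lemma EC3t_short_index2 : (a %% 9 = 2 \/ a %% 9 = 7)%N ->
  index_is (cubic_model 0 (- (27 * a%:R ^+ 2 / 4))) v 2.
Proof.
move=> /cube_root_quarter[x /vge_sub1[x0 x1] ex].
apply: (index2 _ _ _ _ ratr0 ratr_EC3t_a6 (3 * x) 1) => //; rewrite ?vge3M //; last by right.
by rewrite exprMn ex; ring.
Qed.

Lemma EC3t_short_singular x y : vge x 0 -> vge y 1 -> y ^+ 2 = x ^+ 3 - 27 * al ^+ 2 / 4 ->
  vge x 1 /\ vge y 2.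
Proof.
move=> x0 y1 xy; have y2 := vgeX _ _ 2 y1.
have vB : vge (27 * al ^+ 2 / 4) 3.
  by rewrite vge_quarter vge_natM // logn3_27 subrr vgeX0 ?vge_nat.
have ex : x ^+ 3 = y ^+ 2 + 27 * al ^+ 2 / 4 by rewrite xy subrK.
have x1 : vge x 1 by apply: vge_cube; rewrite ex vgeD ?(vge_le 1 2 _ isT y2) ?(vge_le 1 3 _ isT vB).
split=> //; apply: (vgeX_root _ _ 1); rewrite xy; exact: vgeB (vgeX _ _ 3 x1) vB.
Qed.

(** A singular point is [(3 s, 9 t)] with integral [s] and [t], and the equation becomes
    [12 t^2 = 4 s^3 - a^2], impossible modulo 9. *)
Lemma EC3t_short_index1 : (a %% 9 \in [:: 4; 5])%N ->
  index_is (cubic_model 0 (- (27 * a%:R ^+ 2 / 4))) v 1.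
Proof.
move=> a9; apply: (index1_at3 _ _ _ _ ratr0 ratr_EC3t_a6 p3) => // x y x0 y1 xy.
have [x1 y2] := EC3t_short_singular _ _ x0 y1 xy.
have n3 := nat_neq0 3 isT; have n9 := nat_neq0 9 isT; have n4 := nat_neq0 4 isT.
have s0 : vge (x / 3) 0 by rewrite vge_inv // p3.
have t0 : vge (y / 9) 0 by rewrite vge_inv // p3.
move: (x / 3) (y / 9) s0 t0 (divfK n3 x) (divfK n9 y) => s t s0 t0 ex ey.
have st : 12 * t ^+ 2 = 4 * s ^+ 3 - al ^+ 2.
  have n27 := nat_neq0 27 isT; apply: (mulfI n27).
  have -> : 27 * (12 * t ^+ 2) = 4 * y ^+ 2 by rewrite -ey; ring.
  by rewrite xy -ex; field.
have [k sk] := cube_residue _ p3 s0; have [m tm] := residue _ t0.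
have : vge ((4 * k ^ 3)%:R - (a ^ 2 + 12 * m ^ 2)%:R) 2.
  have -> : (4 * k ^ 3)%:R - (a ^ 2 + 12 * m ^ 2)%:R =
      3 * (4 * ((t + m%:R) * (t - m%:R))) - 4 * (s ^+ 3 - k%:R ^+ 3) :> K.
    have -> : 3 * (4 * ((t + m%:R) * (t - m%:R))) = 12 * t ^+ 2 - 12 * m%:R ^+ 2 by ring.
    by rewrite st natrD (natrM _ 4) (natrM _ 12) (natrX _ k 3) (natrX _ a 2) (natrX _ m 2); ring.
  apply: vgeB; last by apply: vgeMl sk; exact: vge_nat.
  rewrite vge3M //; apply: vgeMl; first exact: vge_nat.
  by apply: vgeMl tm; rewrite vgeD ?vge_nat.
by rewrite (vge_natB _ _ 2) p3 (negPf (cube_neq_square_mod9 _ k m a9)).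
Qed.

(** The constant term has valuation exactly 5, but at a singular point [x ^+ 3] and [y ^+ 2] both
    reach valuation 6. *)
Lemma EC3t_short_index1_dvd : (logn p a = 1)%N ->
  index_is (cubic_model 0 (- (27 * a%:R ^+ 2 / 4))) v 1.
Proof.
move=> a1; apply: (index1_at3 _ _ _ _ ratr0 ratr_EC3t_a6 p3) => // x y x0 y1 xy.
have [x1 y2] := EC3t_short_singular _ _ x0 y1 xy.
have vB n : vge (27 * al ^+ 2 / 4) n = (n <= 5).
  by rewrite vge_quarter vge_natM // vge_sq_al a1 logn3_27; clear; lia.
have ex : x ^+ 3 = y ^+ 2 + 27 * al ^+ 2 / 4 by rewrite xy subrK.
have x2 : vge x 2.
  by apply: (vgeX_root _ _ 2); rewrite ex; apply: vgeD (vgeX _ _ 2 y2) _; rewrite vB.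
have x6 := vgeX _ _ 3 x2.
have y3 : vge y 3.
  by apply: (vgeX_root _ _ 1); rewrite xy; apply: vgeB; [exact: vge_le x6 | rewrite vB].
have := vB 6; rewrite (_ : 27 * _ / 4 = x ^+ 3 - y ^+ 2); last by rewrite xy; ring.
by rewrite (vgeB _ _ _ x6 (vgeX _ _ 2 y3)).
Qed.

(** The constant term has valuation exactly 1, while 3 would divide both [x] and [y] at a singular
    point. *)
Lemma EC3t_scaled_index1 : (logn p a = 2)%N ->
  index_is (cubic_model 0 (- (a%:R ^+ 2 / 108))) v 1.
Proof.
move=> a2; apply: (index1_at3 _ _ _ _ ratr0 ratr_EC3t_scaled_a6 p3) => // x y x0 y1 xy.
have vB n : vge (al ^+ 2 / 108) n = (n <= 1).
  by rewrite vge_inv // vge_sq_al a2 (_ : logn p 108 = 3%N) ?p3 //; clear; lia.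
have y2 := vgeX _ _ 2 y1.
have ex : x ^+ 3 = y ^+ 2 + al ^+ 2 / 108 by rewrite xy subrK.
have x1 : vge x 1 by apply: vge_cube; rewrite ex vgeD ?vB // (vge_le 1 2 _ isT y2).
have := vB 2; rewrite (_ : _ / 108 = x ^+ 3 - y ^+ 2); last by rewrite xy; ring.
by rewrite (vgeB _ _ _ (vge_le 2 3 _ isT (vgeX _ _ 3 x1)) y2).
Qed.

End At3.

(** * Bad reduction and the Tamagawa numbers at 3 *)

Hypothesis logn_le2 : (logn p a <= 2)%N.

Lemma bad_EC3 : bad_reduction p (EC3 a) <-> (p %| 3 * a)%N.
Proof.
have [d0 ed] := EC3_disc; have a_log := logn_gt0 p a; rewrite mem_primes p_prime a_gt0 /= in a_log.
rewrite Euclid_dvdM // dvdn_prime2 //; split=> [bad|].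
  apply: contraT; rewrite negb_or => /andP[p3 pa].
  case: (good_reduction _ EC3_wint d0 _ bad).
  by rewrite ed logn27 (negPf p3); move: a_log; rewrite (negPf pa); clear; lia.
move=> pa; apply: (minimal_bad _ _ (isoQ_refl _) (EC3_minimal logn_le2)).
by rewrite ed logn27; case: eqP pa => _; rewrite ?a_log => /= pa; [|move: a_log; rewrite pa]; clear; lia.
Qed.

Lemma bad_EC3t : bad_reduction p (EC3t a) <-> (p %| 3 * a)%N.
Proof.
have [d0 ed] := EC3t_disc; have a_log := logn_gt0 p a; rewrite mem_primes p_prime a_gt0 /= in a_log.
rewrite Euclid_dvdM // dvdn_prime2 //; split=> [bad|].
  apply: contraT; rewrite negb_or => /andP[p3 pa].
  case: (good_reduction _ EC3t_wint d0 _ bad).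
  by rewrite ed logn27 (negPf p3); move: a_log; rewrite (negPf pa); clear; lia.
have [p3 _|p3 /= pa] := eqVneq p 3%N; last first.
  apply: (minimal_bad _ _ (isoQ_refl _) (EC3t_minimal p3 logn_le2)).
  by rewrite ed; move: a_log; rewrite pa; clear; lia.
(* At 3 every model has discriminant of odd valuation [9 + 4 v(a) - 12 n], hence nonzero, so an
   integral one has it positive. *)
have bad E : isoQ (EC3t a) E -> p_minimal p E -> bad_reduction p (EC3t a).
  move=> isoE minE; apply: (minimal_bad _ _ isoE minE).
  have [d0' [n en]] := isoQ_disc _ _ isoE d0.
  have := wint_vp _ (proj1 minE) d0'; rewrite en ed logn3_27 //.
  by clear; lia.
have [le1|gt1] := leqP (logn p a) 1.
  exact: bad EC3t_short_iso (EC3t_short_minimal p3 le1).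
by apply: bad EC3t_scaled_iso (EC3t_scaled_minimal p3 _); apply/eqP; rewrite eqn_leq logn_le2.
Qed.

Lemma tamagawa_at3 : p = 3%N ->
  [/\ (a %% 9 = 1 \/ a %% 9 = 8)%N ->
        tamagawa p K v (EC3 a) 1 /\ tamagawa p K v (EC3t a) 3,
      (a %% 9 = 2 \/ a %% 9 = 7)%N ->
        tamagawa p K v (EC3 a) 2 /\ tamagawa p K v (EC3t a) 2,
      (a %% 9 = 4 \/ a %% 9 = 5)%N ->
        tamagawa p K v (EC3 a) 1 /\ tamagawa p K v (EC3t a) 1
    & (3 %| a)%N ->
        tamagawa p K v (EC3 a) 3 /\ tamagawa p K v (EC3t a) 1].
Proof.
move=> p3.
have min3 : ~~ (3 %| a)%N -> p_minimal p (cubic_model 0 (a%:R ^+ 2 / 4)) /\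
    p_minimal p (cubic_model 0 (- (27 * a%:R ^+ 2 / 4))).
  move=> a3; split; first exact: EC3_short_minimal.
  by apply: EC3t_short_minimal => //; rewrite logn_coprime // coprime3.
split=> a9; last first.
- have pa : (p %| a)%N by rewrite p3.
  split; first exact: tamagawa_minimal (isoQ_refl _) (EC3_minimal logn_le2) (EC3_index3 pa logn_le2).
  (* The minimal model of [EC3t a] depends on the power of 3 in [a]: the short one for 3, the scaled
     one for 9. *)
  have [a1|a2] : logn p a = 1%N \/ logn p a = 2%N.
    by have := dvd_logn pa logn_le2; clear; lia.
  + apply: (tamagawa_minimal _ _ _ EC3t_short_iso); last exact: EC3t_short_index1_dvd.
    by apply: EC3t_short_minimal; rewrite // a1.
  + apply: (tamagawa_minimal _ _ _ EC3t_scaled_iso); last exact: EC3t_scaled_index1.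
    exact: EC3t_scaled_minimal.
all: have [|m m'] := min3; first by move: a9; clear; lia.
all: split; [apply: (tamagawa_minimal _ _ _ EC3_short_iso m) | apply: (tamagawa_minimal _ _ _ EC3t_short_iso m')].
- by apply: EC3_short_index1 => //; rewrite !inE; case: a9 => ->.
- by apply: EC3t_short_index1 => //; rewrite !inE; case: a9 => ->.
- exact: EC3_short_index2.
- exact: EC3t_short_index2.
- by apply: EC3_short_index1 => //; rewrite !inE; case: a9 => ->.
- exact: EC3t_short_index3.
Qed.

End Curves.

End Valuation.

Theorem theorem3p1 (a p : nat) (K : fieldType) (v : K -> int) :
  (0 < a)%N -> cubefree a -> prime p -> is_Qp p K v ->
  [/\ (bad_reduction p (EC3 a) <-> (p %| 3 * a)%N),
      (bad_reduction p (EC3t a) <-> (p %| 3 * a)%N),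
      (p != 3 -> (p %| a)%N ->
         [/\ tamagawa p K v (EC3 a) 3,
             (p %% 6 = 1)%N -> tamagawa p K v (EC3t a) 3
           & (p %% 6 = 2 \/ p %% 6 = 5)%N -> tamagawa p K v (EC3t a) 1])
    & (p = 3 ->
         [/\ (a %% 9 = 1 \/ a %% 9 = 8)%N ->
               tamagawa p K v (EC3 a) 1 /\ tamagawa p K v (EC3t a) 3,
             (a %% 9 = 2 \/ a %% 9 = 7)%N ->
               tamagawa p K v (EC3 a) 2 /\ tamagawa p K v (EC3t a) 2,
             (a %% 9 = 4 \/ a %% 9 = 5)%N ->
               tamagawa p K v (EC3 a) 1 /\ tamagawa p K v (EC3t a) 1
           & (3 %| a)%N ->
               tamagawa p K v (EC3 a) 3 /\ tamagawa p K v (EC3t a) 1])].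
Proof.
move=> a_gt0 cubefree_a p_prime Qp.
have le2 : (logn p a <= 2)%N.
  by rewrite leqNgt -pfactor_dvdn //; apply/negP/cubefree_a.
split.
- exact: (bad_EC3 p K v).
- exact: (bad_EC3t p K v).
- move=> p3 pa; have refl := isoQ_refl; split.
  + apply: tamagawa_minimal (refl _) _ (EC3_index3 p K v p_prime Qp a a_gt0 pa le2).
    exact: (EC3_minimal p K v).
  + move=> p6; apply: tamagawa_minimal (refl _) _ _; first exact: (EC3t_minimal p K v).
    by apply: (EC3t_index3 p K v) => //; move: p6; clear; lia.
  + move=> p6; apply: tamagawa_minimal (refl _) _ _; first exact: (EC3t_minimal p K v).
    by apply: (EC3t_index1 p K v) => //; move: p6; clear; lia.
- exact: tamagawa_at3.
Qed.
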